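(* Let $(B^{n},g)$ be an $n$-dimensional connected Riemannian manifold, let $m\in\mathbb{R}$ with $m\neq 0$ be a constant, and let $f>0$, $\lambda$ and $\varphi$ be three smooth functions on $B$ satisfying $$Ric+\nabla^{2}\varphi=\lambda g+\frac{m}{f}\nabla^{2}f$$ and $$-2\lambda\, d\varphi + d\Big((2-m-n)\lambda + |\nabla\varphi|^{2} - \Delta\varphi - \frac{m}{f}\nabla\varphi(f)\Big)=0.$$ Then there is a constant $\mu\in\mathbb{R}$ such that $$\lambda f^{2}+f\Delta f +(m-1)|\nabla f|^{2} -f\nabla\varphi(f)=\mu \quad\text{on } B.$$
   Context: $Ric$ is the Ricci tensor of $(B,g)$; $\nabla h$, $\nabla^{2}h$ and $\Delta h=\mathrm{tr}(\nabla^{2}h)$ denote the gradient, Hessian and Laplacian of a smooth function $h$ with respect to $g$; $\nabla\varphi(f)=g(\nabla\varphi,\nabla f)$. *)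

(* Defs.v *)
From HB Require Import structures.
From mathcomp Require Import all_boot all_order all_algebra.
From mathcomp Require Import all_classical all_reals all_analysis.
Set Implicit Arguments.
Unset Strict Implicit.
Unset Printing Implicit Defensive.
Import Order.TTheory GRing.Theory Num.Theory.
Import numFieldNormedType.Exports.
Local Open Scope classical_set_scope.
Local Open Scope ring_scope.

Definition partial (R : realType) (n : nat) (i : 'I_n) (F : 'rV[R]_n -> R)
    (x : 'rV[R]_n) : R :=
  'D_(delta_mx 0 i) F x.

(* Only the values of F on U matter as soon as U is open. *)
Fixpoint Ck_on (R : realType) (n : nat) (k : nat) (U : set 'rV[R]_n)
    (F : 'rV[R]_n -> R) : Prop :=
  (forall x, U x -> {for x, continuous F}) /\
  if k is k'.+1 then
    forall i : 'I_n,
      (forall x, U x -> derivable F x (delta_mx 0 i)) /\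
      Ck_on k' U (partial i F)
  else True.

Definition smooth_on (R : realType) (n : nat) (U : set 'rV[R]_n)
    (F : 'rV[R]_n -> R) : Prop :=
  forall k : nat, Ck_on k U F.

(* The maps [cmap] and [cinv] are total, but only their values on [dom] and
   on [cmap @` dom] are meaningful. *)
Record chart (R : realType) (n : nat) (B : topologicalType) := Chart {
  dom : set B;
  cmap : B -> 'rV[R]_n;
  cinv : 'rV[R]_n -> B;
  dom_open : open dom;
  img_open : open (cmap @` dom);
  cmapK : forall p, dom p -> cinv (cmap p) = p;
  cmap_continuous : forall p, dom p -> {for p, continuous cmap};
  cinv_continuous : forall x, (cmap @` dom) x -> {for x, continuous cinv}
}.

Definition img (R : realType) (n : nat) (B : topologicalType)
    (c : chart R n B) : set 'rV[R]_n :=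
  cmap c @` dom c.

(* The smooth structure is given by a smooth atlas, which need not be
   maximal. *)
Record manifold (R : realType) (n : nat) := Manifold {
  carrier :> topologicalType;
  chart_index : Type;
  atlas : chart_index -> chart R n carrier;
  manifold_hausdorff : hausdorff_space carrier;
  manifold_second_countable : @second_countable carrier;
  atlas_cover : forall p : carrier, exists a, dom (atlas a) p;
  atlas_smooth : forall (a b : chart_index) (k : 'I_n),
    smooth_on (cmap (atlas a) @` (dom (atlas a) `&` dom (atlas b)))
      (fun x => cmap (atlas b) (cinv (atlas a) x) 0 k)
}.

Definition smooth (R : realType) (n : nat) (B : manifold R n) (u : B -> R) :
    Prop :=
  forall a : chart_index B, smooth_on (img (atlas a)) (u \o cinv (atlas a)).

(* The partial derivative of u along the i-th coordinate of the chart a, as a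
   function on B; it is meaningful on the domain of a. The differential du has
   components [pd a i u] in the chart a. *)
Definition pd (R : realType) (n : nat) (B : manifold R n) (a : chart_index B)
    (i : 'I_n) (u : B -> R) (p : B) : R :=
  partial i (u \o cinv (atlas a)) (cmap (atlas a) p).

(* [transition_jac a b p] k i is the derivative of the k-th coordinate of the
   chart b along the i-th coordinate of the chart a. *)
Definition transition_jac (R : realType) (n : nat) (B : manifold R n)
    (a b : chart_index B) (p : B) : 'M[R]_n :=
  \matrix_(k, i) pd a i (fun q => cmap (atlas b) q 0 k) p.

(* [metric_comp g a p] is the matrix of g at p in the coordinate frame of the
   chart a. *)
Record riemannian_metric (R : realType) (n : nat) (B : manifold R n) :=
  RiemannianMetric {
  metric_comp :> chart_index B -> B -> 'M[R]_n;
  metric_smooth : forall (a : chart_index B) (i j : 'I_n),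
    smooth_on (img (atlas a))
      (fun x => metric_comp a (cinv (atlas a) x) i j);
  metric_sym : forall (a : chart_index B) (p : B), dom (atlas a) p ->
    (metric_comp a p)^T = metric_comp a p;
  metric_posdef : forall (a : chart_index B) (p : B), dom (atlas a) p ->
    forall v : 'rV[R]_n, v != 0 -> 0 < (v *m metric_comp a p *m v^T) 0 0;
  metric_tensor : forall (a b : chart_index B) (p : B),
    dom (atlas a) p -> dom (atlas b) p ->
    metric_comp a p =
      (transition_jac a b p)^T *m metric_comp b p *m transition_jac a b p
}.

(* In what follows the chart a and p in its domain give the coordinate frame
   in which the tensors at p are expressed. *)
Section Operators.
Variables (R : realType) (n : nat) (B : manifold R n).
Variables (g : riemannian_metric B) (a : chart_index B).

Definition christoffel (k i j : 'I_n) (p : B) : R :=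
  2^-1 * \sum_(l < n) invmx (g a p) k l *
    (pd a i (fun q => g a q j l) p + pd a j (fun q => g a q i l) p
     - pd a l (fun q => g a q i j) p).

(* The coefficient of d_l in R(d_i, d_j) d_k, where
   R(X, Y) Z = D_X D_Y Z - D_Y D_X Z - D_[X, Y] Z. *)
Definition riemann (l i j k : 'I_n) (p : B) : R :=
  pd a i (christoffel l j k) p - pd a j (christoffel l i k) p
  + \sum_(s < n) (christoffel l i s p * christoffel s j k p
                  - christoffel l j s p * christoffel s i k p).

(* Ric(Y, Z) is the trace of X |-> R(X, Y) Z; it is positive on round
   spheres. *)
Definition ricci (p : B) : 'M[R]_n :=
  \matrix_(j, k) \sum_(i < n) riemann i i j k p.

Definition hessian (u : B -> R) (p : B) : 'M[R]_n :=
  \matrix_(i, j) (pd a i (pd a j u) p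
                  - \sum_(k < n) christoffel k i j p * pd a k u p).

Definition laplacian (u : B -> R) (p : B) : R :=
  \tr (invmx (g a p) *m hessian u p).

Definition grad (u : B -> R) (p : B) : 'rV[R]_n :=
  \row_i \sum_(j < n) invmx (g a p) i j * pd a j u p.

Definition inner (p : B) (v w : 'rV[R]_n) : R := (v *m g a p *m w^T) 0 0.

Definition grad_inner (u v : B -> R) (p : B) : R :=
  inner p (grad u p) (grad v p).

End Operators.

(* Main.v *)
Require Import Defs.
From HB Require Import structures.
From mathcomp Require Import all_boot all_order all_algebra.
From mathcomp Require Import all_classical all_reals all_analysis.
From mathcomp Require Import ring lra.
Set Implicit Arguments.
Unset Strict Implicit.
Unset Printing Implicit Defensive.
Import Order.TTheory GRing.Theory Num.Theory.
Import numFieldNormedType.Exports.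
Local Open Scope classical_set_scope.
Local Open Scope ring_scope.

(** Why the theorem holds. Take the divergence of
    Ric + Hess phi = lambda g + (m/f) Hess f. Three identities turn it into an
    equation between differentials: the contracted Bianchi identity
    2 div Ric = d(tr Ric), the Bochner-type identity
    div (Hess u) = d(Delta u) + Ric(grad u), and
    d<grad u, grad v> = Hess u(grad v) + Hess v(grad u). Replacing Ric and its
    trace by what the structure equation says, and adding the second
    hypothesis, everything that involves phi alone cancels; what remains is
    -m/f^2 times the differential of
      lambda f^2 + f Delta f + (m - 1)|grad f|^2 - f <grad phi, grad f>.
    As m is nonzero this function is locally constant, and B is connected.

    This computation never looks at the values of the functions involved, only
    at sums, products and commuting partial derivatives. It is therefore carried
    out in an abstract commutative ring with n commuting derivations and an
    invertible symmetric matrix g ([hamilton_identity]). The connection is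
    encoded by one matrix per coordinate direction, so that curvature is a
    commutator and the second Bianchi identity is a Jacobi identity.

    To apply it in a chart, the smooth functions on an open subset of R^n are
    made into such a ring ([sfun]); this needs the symmetry of second partial
    derivatives ([partialC]), and the conclusion that vanishing partial
    derivatives imply local constancy ([partial0_locally_constant]). Both come
    from the mean value theorem along coordinate lines.

    The constants found in different charts agree because the function does not
    depend on the chart. For gradients this is the chain rule
    ([grad_inner_change]). For the Laplacian, computing how Christoffel symbols
    change is avoided: the Hessian is determined by inner products of gradients
    through
      2 Hess f(grad u, grad v) = <grad u, grad <grad f, grad v>>
        + <grad v, grad <grad f, grad u>> - <grad f, grad <grad u, grad v>>,
    applied to the coordinate functions of one of the charts
    ([laplacian_change]). *)

(** * Riemannian geometry over a commutative ring with derivations *)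

(** Decides identities between matrices that hold in the abelian group
    generated by the products, transposes and derivatives they contain: these
    are abstracted into variables, and the entries compared by [ring]. *)
Ltac mx_group :=
  repeat (let x := fresh "x" in match goal with
    | |- context [@mulmx ?R ?m ?n ?p ?X ?Y] => set x := (@mulmx R m n p X Y)
    | |- context [@trmx ?R ?m ?n ?X] => set x := (@trmx R m n X)
    | |- context [@map_mx ?R ?S ?f ?m ?n ?X] => set x := (@map_mx R S f m n X)
    end; clearbody x);
  let i := fresh "i" in let j := fresh "j" in
  apply/matrixP=> i j; rewrite !mxE; ring.

Section Entries.
Variables (V : zmodType) (p q : nat).
Implicit Types (X Y : 'M[V]_(p, q)).

Lemma entryD X Y i j : (X + Y) i j = X i j + Y i j.
Proof. by rewrite mxE. Qed.

Lemma entryN X i j : (- X) i j = - X i j.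
Proof. by rewrite mxE. Qed.

Lemma entryB X Y i j : (X - Y) i j = X i j - Y i j.
Proof. by rewrite entryD entryN. Qed.

Lemma entry0 i j : (0 : 'M[V]_(p, q)) i j = 0.
Proof. by rewrite mxE. Qed.

Lemma trmxD X Y : (X + Y)^T = X^T + Y^T.
Proof. by apply/matrixP=> i j; rewrite !mxE. Qed.

Lemma trmxN X : (- X)^T = - X^T.
Proof. by apply/matrixP=> i j; rewrite !mxE. Qed.

End Entries.

Lemma entryZ (A : pzRingType) p q (c : A) (X : 'M[A]_(p, q)) i j :
  (c *: X) i j = c * X i j.
Proof. by rewrite mxE. Qed.

(** The elements of A play the role of smooth functions on a coordinate domain
    and D k that of the k-th partial derivative. *)
Section DifferentialRing.
Variables (A : comPzRingType) (n : nat) (D : 'I_n -> {additive A -> A}).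
Hypothesis DM : forall k x y, D k (x * y) = D k x * y + x * D k y.
Hypothesis DC : forall i j x, D i (D j x) = D j (D i x).

Local Notation "''d_' k M" := (map_mx (D k) M)
  (at level 10, k at level 8, M at level 9).

Lemma D1 k : D k 1 = 0.
Proof.
by apply: (addrI (D k 1)); rewrite addr0 -[in RHS](mulr1 1) DM mulr1 mul1r.
Qed.

Lemma dmxM k p q r (M : 'M[A]_(p, q)) (N : 'M[A]_(q, r)) :
  'd_k (M *m N) = 'd_k M *m N + M *m 'd_k N.
Proof.
apply/matrixP=> i j; rewrite !mxE raddf_sum -big_split /=.
by apply: eq_bigr => s _; rewrite !mxE DM.
Qed.

Lemma dmxC i j p q (M : 'M[A]_(p, q)) : 'd_i ('d_j M) = 'd_j ('d_i M).
Proof. by apply/matrixP=> s t; rewrite !mxE DC. Qed.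

Lemma dmx1 k p : 'd_k (1%:M : 'M[A]_p) = 0.
Proof. by apply/matrixP=> i j; rewrite !mxE raddfMn /= D1 mul0rn. Qed.

Lemma dmx_tr k p (M : 'M[A]_p) : D k (\tr M) = \tr ('d_k M).
Proof. by rewrite raddf_sum; apply: eq_bigr => i _; rewrite mxE. Qed.

Variable half : A.
Hypothesis half2 : half + half = 1.
Variables g h : 'M[A]_n.
Hypothesis gT : g^T = g.
Hypothesis hg : h *m g = 1%:M.

Let gh : g *m h = 1%:M := mulmx1C hg.

Let gC i j : g i j = g j i.
Proof. by rewrite -{1}gT mxE. Qed.

Lemma hT : h^T = h.
Proof.
have gh' : g *m h^T = 1%:M by rewrite -{1}gT -trmx_mul hg trmx1.
by rewrite -[LHS]mul1mx -hg -mulmxA gh' mulmx1.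
Qed.

(** The Christoffel symbol with upper index k. *)
Definition chr (k i j : 'I_n) : A :=
  half * \sum_l h k l * (D i (g j l) + D j (g i l) - D l (g i j)).

(** The matrix of the covariant derivative along the k-th coordinate: on column
    vectors (vector fields) it acts as [D k + conn k], on row vectors
    (one-forms) as [D k] minus right multiplication by [conn k]. *)
Definition conn (k : 'I_n) : 'M[A]_n := \matrix_(l, j) chr l k j.

Lemma chrC k i j : chr k i j = chr k j i.
Proof.
by congr (_ * _); apply: eq_bigr => l _; rewrite (gC i j) [D i _ + _]addrC.
Qed.

Lemma conn_lower k l j :
  (g *m conn k) l j = half * (D k (g j l) + D j (g k l) - D l (g k j)).
Proof.
pose T : 'M[A]_n :=
  \matrix_(l, j) (half * (D k (g j l) + D j (g k l) - D l (g k j))).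
have -> : conn k = h *m T.
  apply/matrixP=> a b; rewrite !mxE /chr mulr_sumr.
  by apply: eq_bigr => s _; rewrite mxE mulrCA.
by rewrite mulmxA gh mul1mx mxE.
Qed.

(** The metric is parallel: [conn_lower] shows that the terms of g * conn k
    other than the derivative of g along k are skew. *)
Lemma dmx_g k : 'd_k g = g *m conn k + (conn k)^T *m g.
Proof.
rewrite -[(conn k)^T *m g]trmxK trmx_mul trmxK gT.
apply/matrixP=> i j.
rewrite mxE [RHS]mxE [_^T i j]mxE !conn_lower (gC j i).
by rewrite -[LHS]mul1r -half2; ring.
Qed.

Lemma dmx_h k : 'd_k h = - (conn k *m h + h *m (conn k)^T).
Proof.
have e : 'd_k h *m g = - (h *m 'd_k g).
  by apply/eqP; rewrite -addr_eq0 -dmxM hg dmx1.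
rewrite -['d_k h]mulmx1 -gh mulmxA e dmx_g mulNmx mulmxDr mulmxDl.
by rewrite (mulmxA h g) hg mul1mx -!mulmxA gh mulmx1.
Qed.

(** The curvature endomorphism R(d_i, d_j): the commutator of [D i + conn i]
    and [D j + conn j]. *)
Definition curv (i j : 'I_n) : 'M[A]_n :=
  'd_i (conn j) - 'd_j (conn i) + (conn i *m conn j - conn j *m conn i).

Definition ric : 'M[A]_n := \matrix_(j, k) \sum_i curv i j i k.

Lemma curvC i j : curv i j = - curv j i.
Proof. by rewrite /curv; mx_group. Qed.

(** The operators R(d_i, d_j) are skew for the metric. As h is parallel, this
    is what the commutation of D i and D j on h says. *)
Lemma curv_skew i j : curv i j *m h = - (curv i j *m h)^T.
Proof.
have := dmxC i j h; rewrite !dmx_h !map_mxN !map_mxD !dmxM !dmx_h.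
rewrite -!map_trmx /curv trmx_mul hT.
rewrite !(trmxD, trmxN) !trmx_mul.
rewrite !(mulmxDl, mulmxDr, mulmxN, mulNmx, opprD, opprK, mulmxA) => /eqP.
rewrite -subr_eq0 => /eqP e; apply/eqP; rewrite -subr_eq0 -oppr_eq0 -e.
by apply/eqP; mx_group.
Qed.

(** The covariant derivative, along the k-th coordinate, of the covariant
    2-tensor with matrix T. *)
Definition nabla (k : 'I_n) (T : 'M[A]_n) : 'M[A]_n :=
  'd_k T - (conn k)^T *m T - T *m conn k.

Definition divergence (T : 'M[A]_n) (j : 'I_n) : A :=
  \sum_k \sum_i h k i * nabla k T i j.

Definition dif (u : A) : 'rV[A]_n := \row_i D i u.

Definition hess (u : A) : 'M[A]_n :=
  \matrix_(i, j) (D i (D j u) - \sum_k chr k i j * D k u).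

Definition lap (u : A) : A := \tr (h *m hess u).

Definition gdot (u v : A) : A := (dif u *m h *m (dif v)^T) 0 0.

Lemma nabla_g k : nabla k g = 0.
Proof. by rewrite /nabla dmx_g; mx_group. Qed.

(** The trace with respect to the metric commutes with covariant derivatives,
    because h is parallel. *)
Lemma dmx_trace k T : D k (\tr (h *m T)) = \tr (h *m nabla k T).
Proof.
rewrite dmx_tr dmxM dmx_h /nabla !(mulmxBr, mulmxDl, mulNmx) opprD.
rewrite !mxtraceD !raddfN /= !mulmxA.
rewrite -(mulmxA _ h T) mxtrace_mulC; ring.
Qed.

Lemma nablaD k T S : nabla k (T + S) = nabla k T + nabla k S.
Proof.
by rewrite /nabla map_mxD !(mulmxDl, mulmxDr); mx_group.
Qed.

Lemma nablaZ k c T : nabla k (c *: T) = D k c *: T + c *: nabla k T.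
Proof.
have -> : nabla k (c *: T) =
    'd_k (c *: T) - c *: ((conn k)^T *m T + T *m conn k).
  by rewrite /nabla -scalemxAr -scalemxAl; mx_group.
rewrite /nabla; apply/matrixP=> i j; rewrite !mxE DM; ring.
Qed.

Lemma divergenceD T S j :
  divergence (T + S) j = divergence T j + divergence S j.
Proof.
rewrite -big_split; apply: eq_bigr => k _; rewrite -big_split.
by apply: eq_bigr => i _; rewrite nablaD !mxE mulrDr.
Qed.

Lemma divergenceZ c T j :
  divergence (c *: T) j = (dif c *m h *m T) 0 j + c * divergence T j.
Proof.
rewrite /divergence mulr_sumr mxE.
under [X in _ = X + _]eq_bigr do rewrite mxE mulr_suml.
rewrite [X in _ = X + _]exchange_big /= -big_split; apply: eq_bigr => k _.
rewrite mulr_sumr -big_split; apply: eq_bigr => i _.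
by rewrite nablaZ; move: (nabla k T) => N; rewrite !mxE /=; ring.
Qed.

Lemma divergence_conformal c j : divergence (c *: g) j = D j c.
Proof.
rewrite divergenceZ -mulmxA hg mulmx1 mxE.
rewrite /divergence big1 ?mulr0 ?addr0 // => k _.
by rewrite big1 // => i _; rewrite nabla_g mxE mulr0.
Qed.

Lemma hessC u i j : hess u i j = hess u j i.
Proof.
rewrite !mxE DC; congr (_ - _); apply: eq_bigr => k _.
by rewrite chrC.
Qed.

Lemma hessT u : (hess u)^T = hess u.
Proof. by apply/matrixP=> i j; rewrite mxE hessC. Qed.

Lemma row_hess u i : row i (hess u) = 'd_i (dif u) - dif u *m conn i.
Proof.
apply/rowP=> j; rewrite !mxE; congr (_ - _).
by apply: eq_bigr => k _; rewrite !mxE mulrC.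
Qed.

(** The Ricci identity: rows of the Hessian are covariant derivatives of the
    one-form du, whose commutator is the curvature. The Christoffel correction
    for the other index is symmetric and cancels. *)
Lemma nabla_hess_swap u k j i :
  nabla k (hess u) i j - nabla j (hess u) i k = - (dif u *m curv k j) 0 i.
Proof.
have E a b : nabla a (hess u) i b =
    ('d_a (row b (hess u)) - row b (hess u) *m conn a) 0 i
    - \sum_s hess u i s * chr s a b.
  rewrite /nabla !entryB -row_mul [row _ _ _ _]mxE -{2}hessT -trmx_mul.
  congr (_ - _ - _).
  - by rewrite [LHS]mxE [RHS]mxE hessC; congr (D _ _); rewrite [RHS]mxE.
  - by rewrite [LHS]mxE.
  - by rewrite mxE; apply: eq_bigr => s _; rewrite [conn _ _ _]mxE.
rewrite !E.
have -> : \sum_s hess u i s * chr s k j = \sum_s hess u i s * chr s j k.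
  by apply: eq_bigr => s _; rewrite chrC.
rewrite opprB addrA subrK !row_hess.
have -> : dif u *m curv k j = - (('d_k ('d_j (dif u) - dif u *m conn j) -
   ('d_j (dif u) - dif u *m conn j) *m conn k) -
   ('d_j ('d_k (dif u) - dif u *m conn k) -
   ('d_k (dif u) - dif u *m conn k) *m conn j)).
  rewrite !map_mxB !dmxM (dmxC j k) /curv.
  by rewrite !(mulmxBr, mulmxDr, mulmxBl, mulmxN, mulmxA); mx_group.
by rewrite entryN opprK !entryB.
Qed.

(** Contract [nabla_hess_swap]; the skewness of the curvature moves its trace to
    the pair of indices that defines the Ricci tensor. *)
Lemma divergence_hess u j : divergence (hess u) j =
  D j (lap u) + (dif u *m h *m ric^T) 0 j.
Proof.
have -> : D j (lap u) = \sum_k \sum_i h k i * nabla j (hess u) i k.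
  by rewrite /lap dmx_trace; apply: eq_bigr => k _; rewrite mxE.
rewrite mxE.
under [X in _ = _ + X]eq_bigr do rewrite [_^T _ _]mxE [ric _ _]mxE mulr_sumr.
rewrite [X in _ = _ + X]exchange_big -big_split; apply: eq_bigr => k _ /=.
have -> : \sum_i (dif u *m h) 0 i * curv k j k i =
    - \sum_i h k i * (dif u *m curv k j) 0 i.
  transitivity ((dif u *m h *m (curv k j)^T) 0 k).
    by rewrite [RHS]mxE; apply: eq_bigr => i _; rewrite [_^T _ _]mxE.
  rewrite -mulmxA -{1}hT -trmx_mul -[(_ *m h)^T]opprK -curv_skew mulmxN entryN.
  rewrite mulmxA mxE; congr (- _); apply: eq_bigr => i _.
  by rewrite mulrC -{1}hT mxE.
rewrite -sumrN -big_split; apply: eq_bigr => i _ /=.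
by rewrite -mulrBr -(nabla_hess_swap u k j i) addrC subrK.
Qed.

Lemma gdotC u v : gdot u v = gdot v u.
Proof.
have -> : gdot u v = (dif v *m h *m (dif u)^T)^T 0 0.
  by rewrite !trmx_mul trmxK hT mulmxA.
by rewrite mxE.
Qed.

Lemma D_gdot j u v :
  D j (gdot u v) = (dif u *m h *m hess v) 0 j + (dif v *m h *m hess u) 0 j.
Proof.
have aux a b : (dif a *m h *m hess b) 0 j =
    (dif a *m h *m (row j (hess b))^T) 0 0.
  by rewrite tr_row hessT colE mulmxA -colE [RHS]mxE.
have -> : D j (gdot u v) = ('d_j (dif u *m h *m (dif v)^T)) 0 0.
  by rewrite [RHS]mxE.
have -> : 'd_j (dif u *m h *m (dif v)^T) =
    row j (hess u) *m h *m (dif v)^T + dif u *m h *m (row j (hess v))^T.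
  rewrite !dmxM dmx_h !row_hess trmxD trmxN trmx_mul map_trmx.
  rewrite !(mulmxDl, mulmxDr, mulmxBl, mulmxBr, mulNmx, mulmxN, mulmxA).
  by mx_group.
rewrite entryD addrC !aux; congr (_ + _).
have -> : row j (hess u) *m h *m (dif v)^T =
    (dif v *m h *m (row j (hess u))^T)^T.
  by rewrite !trmx_mul trmxK hT mulmxA.
by rewrite mxE.
Qed.

(** The derivative of the curvature as an endomorphism-valued expression: the
    two form indices i and j are not differentiated covariantly. *)
Definition dcurv (m i j : 'I_n) : 'M[A]_n :=
  'd_m (curv i j) + (conn m *m curv i j - curv i j *m conn m).

(** This is the Jacobi identity for the operators [D k + conn k]. *)
Lemma second_bianchi m i j : dcurv m i j + dcurv i j m + dcurv j m i = 0.
Proof.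
rewrite /dcurv /curv !(map_mxD, map_mxN) !dmxM (dmxC i m) (dmxC j m) (dmxC j i).
rewrite !(mulmxDl, mulmxDr, mulmxN, mulNmx, mulmxA).
by mx_group.
Qed.

(** The full covariant derivative of the curvature. Its contractions are
    tensors, and the corrections added to [dcurv] cancel in cyclic sums. *)
Definition nabla_curv (m i j : 'I_n) : 'M[A]_n :=
  dcurv m i j - \sum_s chr s m i *: curv s j - \sum_s chr s m j *: curv i s.

Lemma nabla_curvC m i j : nabla_curv m i j = - nabla_curv m j i.
Proof.
rewrite /nabla_curv /dcurv (curvC j i) map_mxN !(mulNmx, mulmxN).
under [X in _ = - (_ - X - _)]eq_bigr do rewrite curvC scalerN.
under [X in _ = - (_ - _ - X)]eq_bigr do rewrite curvC scalerN.
rewrite !sumrN; move: (\sum_s _) (\sum_s _) => X Y.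
by mx_group.
Qed.

Lemma nabla_curv_skew m i j :
  nabla_curv m i j *m h = - (nabla_curv m i j *m h)^T.
Proof.
have skew_sum (F : 'I_n -> A) (C : 'I_n -> 'M[A]_n) :
    (forall s, C s *m h = - (C s *m h)^T) ->
    (\sum_s F s *: C s) *m h = - ((\sum_s F s *: C s) *m h)^T.
  move=> Cskew; rewrite mulmx_suml linear_sum -sumrN; apply: eq_bigr => s _.
  by rewrite -scalemxAl {1}Cskew linearZ scalerN.
have skewB (X Y : 'M[A]_n) : X *m h = - (X *m h)^T -> Y *m h = - (Y *m h)^T ->
    (X - Y) *m h = - ((X - Y) *m h)^T.
  by move=> hX hY; rewrite mulmxBl trmxD trmxN {1}hX {1}hY; mx_group.
apply: (skewB); first apply: (skewB).
- have -> : dcurv m i j *m h = 'd_m (curv i j *m h) +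
      (conn m *m (curv i j *m h) + curv i j *m h *m (conn m)^T).
    rewrite dmxM dmx_h /dcurv.
    by rewrite !(mulmxDl, mulmxDr, mulNmx, mulmxN, mulmxA); mx_group.
  rewrite [in LHS](curv_skew i j).
  move: (curv i j *m h) => X.
  rewrite !(trmxD, trmxN) !trmx_mul !trmxK map_mxN map_trmx.
  by rewrite !(mulmxN, mulNmx); mx_group.
- by apply: skew_sum => s; apply: curv_skew.
- by apply: skew_sum => s; apply: curv_skew.
Qed.

Lemma nabla_second_bianchi m i j :
  nabla_curv m i j + nabla_curv i j m + nabla_curv j m i = 0.
Proof.
have swap (a b c d : 'I_n) :
    \sum_s chr s a b *: curv s c = - \sum_s chr s b a *: curv c s.
  by rewrite -sumrN; apply: eq_bigr => s _; rewrite chrC curvC scalerN.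
rewrite -(second_bianchi m i j) /nabla_curv.
rewrite (swap m i j j) (swap i j m m) (swap j m i i).
move: (\sum_s _) (\sum_s _) (\sum_s _) => X Y Z.
move: (dcurv m i j) (dcurv i j m) (dcurv j m i) => U V W.
by mx_group.
Qed.

Lemma nabla_ric m j k :
  nabla m ric j k = \sum_i nabla_curv m i j i k.
Proof.
have connE s t : conn m s t = chr s m t by rewrite mxE.
have ricE s t : ric s t = \sum_i curv i s i t by rewrite mxE.
have entry i : nabla_curv m i j i k = D m (curv i j i k)
    + (\sum_s chr i m s * curv i j s k - \sum_s curv i j i s * chr s m k)
    - \sum_s chr s m i * curv s j i k - \sum_s chr s m j * curv i s i k.
  rewrite !entryB entryD entryB !summxE; congr (_ + (_ - _) - _ - _).
  - by rewrite [LHS]mxE.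
  - by rewrite [LHS]mxE; apply: eq_bigr => s _; rewrite connE.
  - by rewrite [LHS]mxE; apply: eq_bigr => s _; rewrite connE.
  - by apply: eq_bigr => s _; rewrite [LHS]mxE.
  - by apply: eq_bigr => s _; rewrite [LHS]mxE.
under [RHS]eq_bigr do rewrite entry.
rewrite !(big_split, sumrN) /=.
rewrite [\sum_i \sum_s chr s m i * _]exchange_big /=.
set a := \sum_i \sum_s _; set b := \sum_i \sum_s curv _ _ _ _ * _.
set c := \sum_i \sum_s _.
have -> : nabla m ric j k = \sum_i D m (curv i j i k) - c - b.
  rewrite /nabla !entryB; congr (_ - _ - _).
  - by rewrite [LHS]mxE ricE raddf_sum.
  - rewrite [LHS]mxE /c exchange_big; apply: eq_bigr => s _ /=.
    by rewrite [_^T _ _]mxE connE ricE mulr_sumr.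
  - rewrite [LHS]mxE /b exchange_big; apply: eq_bigr => s _ /=.
    by rewrite connE ricE mulr_suml.
ring.
Qed.

(** Trace the cyclic identity twice. Two of the three terms become the
    divergence of the Ricci tensor, the second of them after the skewness of
    the curvature exchanges its indices; the third becomes minus the derivative
    of the scalar curvature. *)
Lemma contracted_bianchi j : ric^T = ric ->
  divergence ric j + divergence ric j = D j (\tr (h *m ric)).
Proof.
move=> ricT; have hC a b : h a b = h b a by rewrite -{1}hT mxE.
have nabla_ricC a b c : nabla a ric b c = nabla a ric c b.
  have nablaT : (nabla a ric)^T = nabla a ric.
    by rewrite /nabla !(trmxD, trmxN) !trmx_mul trmxK map_trmx ricT; mx_group.
  by rewrite -{1}nablaT [LHS]mxE.
have divE : divergence ric j =
    \sum_m \sum_k h m k * \sum_i nabla_curv m i j i k.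
  by do 2![apply: eq_bigr => ? _]; rewrite nabla_ricC nabla_ric.
have divE' : divergence ric j =
    \sum_m \sum_k h m k * \sum_i nabla_curv i j m i k.
  transitivity (\sum_i \sum_m (nabla_curv i j m *m h) i m); last first.
    rewrite exchange_big; apply: eq_bigr => m _ /=.
    under [RHS]eq_bigr do rewrite mulr_sumr.
    rewrite exchange_big; apply: eq_bigr => i _ /=.
    by rewrite mxE; apply: eq_bigr => k _; rewrite mulrC hC.
  rewrite divE; apply: eq_bigr => i _.
  have -> : \sum_m (nabla_curv i j m *m h) i m =
      \sum_m (nabla_curv i m j *m h) m i.
    apply: eq_bigr => m _.
    rewrite nabla_curv_skew entryN [_^T _ _]mxE nabla_curvC mulNmx entryN.
    exact: opprK.
  under [LHS]eq_bigr do rewrite mulr_sumr.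
  rewrite exchange_big; apply: eq_bigr => m _ /=.
  by rewrite mxE; apply: eq_bigr => k _; rewrite mulrC hC.
have traceE : D j (\tr (h *m ric)) =
    - \sum_m \sum_k h m k * \sum_i nabla_curv j m i i k.
  rewrite dmx_trace -sumrN; apply: eq_bigr => m _.
  rewrite mxE -sumrN; apply: eq_bigr => k _.
  rewrite nabla_ricC nabla_ric -mulrN -sumrN; congr (_ * _).
  by apply: eq_bigr => i _; rewrite nabla_curvC entryN.
apply/eqP; rewrite -subr_eq0 traceE opprK {1}divE divE' -!big_split /=.
apply/eqP/big1 => m _; rewrite -!big_split /=; apply: big1 => k _.
rewrite -!mulrDr -!big_split /= big1 ?mulr0 // => i _.
by rewrite -!entryD nabla_second_bianchi mxE.
Qed.

(** The Hessian is determined by the inner products of gradients. As inner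
    products only involve first derivatives, this gives the behaviour of the
    Hessian under changes of coordinates without second derivatives of the
    coordinates. *)
Lemma hess_gdot f u v :
  (dif u *m h *m hess f *m h *m (dif v)^T) 0 0 * 2 =
  gdot u (gdot f v) + gdot v (gdot f u) - gdot f (gdot u v).
Proof.
have dif_gdot a b :
    dif (gdot a b) = dif a *m h *m hess b + dif b *m h *m hess a.
  by apply/rowP=> j; rewrite [LHS]mxE D_gdot entryD.
pose H a b c := (dif b *m h *m hess a *m h *m (dif c)^T) 0 0.
have HC a b c : H a b c = H a c b.
  have -> : H a b c = (dif b *m h *m hess a *m h *m (dif c)^T)^T 0 0.
    by rewrite [RHS]mxE.
  by rewrite !trmx_mul trmxK hT hessT !mulmxA.
have gdot_gdot a b c : gdot a (gdot b c) = H c b a + H b c a.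
  by rewrite gdotC /gdot dif_gdot !mulmxDl entryD.
rewrite -/(H f u v) !gdot_gdot (HC f v u) (HC u v f) (HC v u f); ring.
Qed.

(** Evaluating at a point is a ring morphism. The formulas below express the
    values of the geometric quantities through those of the metric and of
    derivatives, in the shape of their definitions on a manifold. *)
Section Evaluation.
Variables (A' : comPzRingType) (ev : {rmorphism A -> A'}).

Lemma rmorph_chr k i j : ev (chr k i j) = ev half *
  \sum_l ev (h k l) * (ev (D i (g j l)) + ev (D j (g i l)) - ev (D l (g i j))).
Proof.
rewrite rmorphM rmorph_sum; congr (_ * _); apply: eq_bigr => l _.
by rewrite rmorphM rmorphB rmorphD.
Qed.

Lemma rmorph_ric j k : ev (ric j k) =
  \sum_i (ev (D i (chr i j k)) - ev (D j (chr i i k))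
    + \sum_s (ev (chr i i s) * ev (chr s j k)
              - ev (chr i j s) * ev (chr s i k))).
Proof.
rewrite mxE rmorph_sum; apply: eq_bigr => i _.
rewrite /curv !mxE rmorphD rmorphB rmorphB !rmorph_sum sumrB.
by congr (_ + (_ - _)); apply: eq_bigr => s _; rewrite !mxE rmorphM.
Qed.

Lemma rmorph_hess u i j : ev (hess u i j) =
  ev (D i (D j u)) - \sum_k ev (chr k i j) * ev (D k u).
Proof.
rewrite mxE rmorphB rmorph_sum; congr (_ - _).
by apply: eq_bigr => k _; rewrite rmorphM.
Qed.

Lemma rmorph_lap u : ev (lap u) = \tr (map_mx ev h *m map_mx ev (hess u)).
Proof. by rewrite -map_mxM trace_map_mx. Qed.

Lemma rmorph_gdot u v :
  ev (gdot u v) =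
  (map_mx ev (dif u) *m map_mx ev h *m (map_mx ev (dif v))^T) 0 0.
Proof. by rewrite map_trmx -!map_mxM [RHS]mxE. Qed.

Lemma rmorph_hess_gdot f u v :
  (map_mx ev (dif u) *m map_mx ev h *m map_mx ev (hess f) *m map_mx ev h
     *m (map_mx ev (dif v))^T) 0 0 * 2 =
  ev (gdot u (gdot f v)) + ev (gdot v (gdot f u)) - ev (gdot f (gdot u v)).
Proof.
rewrite -rmorphD -rmorphB -hess_gdot rmorphM rmorph_nat map_trmx.
by rewrite -!map_mxM mxE.
Qed.

End Evaluation.

(** The two hypotheses of the theorem, with w standing for 1/f. *)
Section QuasiEinstein.
Variables (lam phi f w m minv : A).
Hypotheses (Dm : forall i, D i m = 0) (mV : m * minv = 1) (wf : w * f = 1).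
Hypothesis structure_eq : ric + hess phi = lam *: g + (m * w) *: hess f.
Hypothesis differential_eq : forall i, - 2 * lam * D i phi
  + D i ((2 - m - n%:R) * lam + gdot phi phi - lap phi
         - m * w * gdot phi f) = 0.

Lemma D_inv i : D i w = - (w * w) * D i f.
Proof.
have e : D i w * f = - (w * D i f).
  by apply/eqP; rewrite -addr_eq0 -DM wf D1.
by rewrite -[LHS]mulr1 -wf mulrCA mulrC e; ring.
Qed.

(** The conclusion is obtained as -f^2/m times the difference between the
    second hypothesis and the contracted Bianchi identity for the Ricci tensor
    prescribed by the first hypothesis. *)
Lemma hamilton_identity i :
  D i (lam * f ^+ 2 + f * lap f + (m - 1) * gdot f f - f * gdot phi f) = 0.
Proof.
(* X u v is Hess v (grad u, d_i). *)
pose X u v := (dif u *m h *m hess v) 0 i.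
have ricE : ric = lam *: g - hess phi + (m * w) *: hess f.
  by rewrite addrAC -structure_eq addrK.
have ricT : ric^T = ric.
  by rewrite ricE !linearD /= linearN !linearZ /= gT !hessT.
have Dn : D i n%:R = 0 by rewrite raddfMn /= D1 mul0rn.
have ric_grad u : (dif u *m h *m ric^T) 0 i
    = lam * D i u - X u phi + m * w * X u f.
  rewrite ricT ricE mulmxDr mulmxBr entryD entryB -!scalemxAr -mulmxA hg mulmx1.
  by rewrite !entryZ [dif u 0 i]mxE.
have scalE : \tr (h *m ric) = n%:R * lam - lap phi + m * w * lap f.
  rewrite ricE mulmxDr mulmxBr -!scalemxAr hg !linearD /= linearN !linearZ /=.
  by rewrite mxtrace1 mulrC.
have divE : divergence ric i = D i lam
    - (D i (lap phi) + (lam * D i phi - X phi phi + m * w * X phi f))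
    + (- m * (w * w) * X f f
    + m * w * (D i (lap f) + (lam * D i f - X f phi + m * w * X f f))).
  rewrite {1}ricE !divergenceD divergence_conformal.
  rewrite -[- hess phi]scaleN1r !divergenceZ !divergence_hess !ric_grad.
  have -> : dif (-1) = 0.
    by apply/rowP=> k; rewrite !mxE raddfN /= D1 oppr0.
  have -> : dif (m * w) = (- m * (w * w)) *: dif f.
    by apply/rowP=> k; rewrite !mxE DM Dm D_inv; ring.
  rewrite !mul0mx -!scalemxAl entryZ -/(X f f) entry0.
  ring.
have dotE u v : D i (gdot u v) = X u v + X v u by exact: D_gdot.
have bianchi := contracted_bianchi i ricT.
rewrite scalE divE !(raddfD, raddfN, DM, Dm, Dn, D_inv) /= in bianchi.
have dif_eq := differential_eq i.
rewrite !(raddfD, raddfN, DM, Dm, Dn, D1, D_inv, dotE) /= in dif_eq.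
rewrite !(raddfD, raddfN, DM, Dm, D1, dotE) /=.
move/eqP: bianchi; rewrite -subr_eq0 => /eqP bianchi.
(* Both equations become polynomial identities in the remaining quantities,
   related by m * minv = 1 and w * f = 1 only. *)
have key a b : a = 0 -> b = 0 -> minv * - f ^+ 2 * (b - a) = 0.
  by move=> -> ->; rewrite subrr mulr0.
rewrite -(key _ _ bianchi dif_eq).
by ring: mV wf.
Qed.

End QuasiEinstein.

End DifferentialRing.

(** * Functions of class C^k on open sets *)

Section Ck.
Variables (R : realType) (n : nat).
Implicit Types (U : set 'rV[R]_n) (F G : 'rV[R]_n -> R).

Lemma near_open U (P : 'rV[R]_n -> Prop) x : open U -> U x ->
  (forall y, U y -> P y) -> \forall y \near x, P y.
Proof. by move=> Uo Ux UP; apply: (filterS UP); apply: open_nbhs_nbhs. Qed.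

Lemma partial_ext U F G i x : open U -> (forall y, U y -> F y = G y) -> U x ->
  partial i F x = partial i G x.
Proof. by move=> Uo FG Ux; apply/near_eq_derive/(near_open Uo Ux FG). Qed.

Lemma Ck_on_continuous k U F x : Ck_on k U F -> U x -> {for x, continuous F}.
Proof. by case: k => [|k] [cF _]; apply: cF. Qed.

Lemma continuous_near F G x : (\forall y \near x, F y = G y) ->
  {for x, continuous F} -> {for x, continuous G}.
Proof.
move=> FG cF; rewrite /prop_for /continuous_at -(nbhs_singleton FG).
exact: cvg_trans (near_eq_cvg FG) cF.
Qed.

Lemma Ck_on_ext k U F G : open U -> (forall y, U y -> F y = G y) ->
  Ck_on k U F -> Ck_on k U G.
Proof.
move=> Uo; elim: k F G => [|k IH] F G FG CF; split=> //.
- move=> x Ux; apply: continuous_near (Ck_on_continuous CF Ux).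
  exact: near_open Ux FG.
- move=> x Ux; apply: continuous_near (Ck_on_continuous CF Ux).
  exact: near_open Ux FG.
- move=> i; have [_ /(_ i)[dF CdF]] := CF; split.
    move=> x Ux; apply: near_eq_derivable (dF x Ux).
    exact: (near_open Uo Ux).
  by apply: IH CdF => y Uy; apply: (partial_ext _ Uo FG Uy).
Qed.

Lemma Ck_on_sub k U U' F : U' `<=` U -> Ck_on k U F -> Ck_on k U' F.
Proof.
move=> sU; elim: k F => [|k IH] F [cF dF]; split=> //.
- by move=> x /sU; apply: cF.
- by move=> x /sU; apply: cF.
- move=> i; have [dFi CFi] := dF i; split; last exact: IH.
  by move=> x /sU; apply: dFi.
Qed.

Lemma Ck_onS k U F : Ck_on k.+1 U F -> Ck_on k U F.
Proof.
elim: k F => [|k IH] F [cF dF]; split=> // i.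
by have [dFi CFi] := dF i; split=> //; apply: IH.
Qed.

Lemma Ck_on_cst k U c : Ck_on k U (cst c).
Proof.
elim: k c => [|k IH] c; split=> //; try by move=> x _; apply: cst_continuous.
move=> i; split; first by move=> x _; apply: derivable_cst.
suff -> : partial i (cst c) = cst 0 by [].
by apply/funext => x; rewrite /partial derive_cst.
Qed.

Lemma Ck_onD k U F G : open U ->
  Ck_on k U F -> Ck_on k U G -> Ck_on k U (F + G).
Proof.
move=> Uo; elim: k F G => [|k IH] F G CF CG; split=> //.
- by move=> x Ux; apply: continuousD; apply: Ck_on_continuous Ux; eassumption.
- by move=> x Ux; apply: continuousD; apply: Ck_on_continuous Ux; eassumption.
- move=> i; have [_ /(_ i)[dF CdF]] := CF; have [_ /(_ i)[dG CdG]] := CG.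
  split; first by move=> x Ux; apply: derivableD; [exact: dF|exact: dG].
  apply: Ck_on_ext (IH _ _ CdF CdG) => // y Uy.
  by rewrite /partial deriveD; [|exact: dF|exact: dG].
Qed.

Lemma Ck_onM k U F G : open U ->
  Ck_on k U F -> Ck_on k U G -> Ck_on k U (F * G).
Proof.
move=> Uo; elim: k F G => [|k IH] F G CF CG; split=> //.
- by move=> x Ux; apply: continuousM; apply: Ck_on_continuous Ux; eassumption.
- by move=> x Ux; apply: continuousM; apply: Ck_on_continuous Ux; eassumption.
- move=> i; have [_ /(_ i)[dF CdF]] := CF; have [_ /(_ i)[dG CdG]] := CG.
  split; first by move=> x Ux; apply: derivableM; [exact: dF|exact: dG].
  have FdG := IH _ _ (Ck_onS CF) CdG; have GdF := IH _ _ (Ck_onS CG) CdF.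
  apply: Ck_on_ext (Ck_onD Uo FdG GdF) => // y Uy.
  by rewrite /partial deriveM; [|exact: dF|exact: dG].
Qed.

Lemma Ck_onV k U F : open U -> (forall y, U y -> F y != 0) ->
  Ck_on k U F -> Ck_on k U (fun y => (F y)^-1).
Proof.
move=> Uo F0; elim: k F F0 => [|k IH] F F0 CF; split=> //.
- by move=> x Ux; apply: continuousV; [exact: F0|exact: Ck_on_continuous CF Ux].
- by move=> x Ux; apply: continuousV; [exact: F0|exact: Ck_on_continuous CF Ux].
- move=> i; have [_ /(_ i)[dF CdF]] := CF.
  split; first by move=> x Ux; apply: derivableV; [exact: F0|exact: dF].
  have CV := IH _ F0 (Ck_onS CF).
  have V2dF := Ck_onM Uo (Ck_onM Uo CV CV) CdF.
  apply: Ck_on_ext (Ck_onM Uo (Ck_on_cst k U (-1)) V2dF) => // y Uy.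
  rewrite /partial deriveV; [|exact: F0|exact: dF].
  rewrite -[LHS]/(-1 * ((F y)^-1 * (F y)^-1 * _)).
  by rewrite -[RHS]/(- (F y ^+ 2)^-1 * _) mulrA mulN1r expr2 invfM.
Qed.

Lemma smooth_on_partial U F i : smooth_on U F -> smooth_on U (partial i F).
Proof. by move=> sF k; have [_ /(_ i)[]] := sF k.+1. Qed.

Lemma smooth_on_derivable U F i x :
  smooth_on U F -> U x -> derivable F x (delta_mx 0 i).
Proof. by move=> sF Ux; have [_ /(_ i)[dF _]] := sF 1%N; apply: dF. Qed.

End Ck.

(** * Mean value theorems, symmetry of second derivatives, chain rule *)

Section MeanValue.
Variables (R : realType) (n : nat).
Implicit Types (U : set 'rV[R]_n) (F G : 'rV[R]_n -> R) (x y z : 'rV[R]_n).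

Lemma is_derive_line F x v (t : R) : derivable F (x + t *: v) v ->
  is_derive t 1 (fun s => F (x + s *: v)) ('D_v F (x + t *: v)).
Proof.
have e : (fun h : R => h^-1 *:
      (((fun s => F (x + s *: v)) \o shift t) (h *: 1) - F (x + t *: v))) =
    (fun h => h^-1 *: ((F \o shift (x + t *: v)) (h *: v) - F (x + t *: v))).
  apply/funext => h /=; congr (_ *: (F _ - _)).
  by rewrite [h *: 1]mulr1 scalerDl addrCA.
by move=> dF; split; rewrite /derivable /derive e.
Qed.

Lemma partial_shift F x w i :
  partial i (fun y => F (y + w)) x = partial i F (x + w).
Proof.
rewrite /partial /derive.
set a := (X in lim (X @ _) = _); set b := (X in _ = lim (X @ _)).
suff -> : a = b by [].
by apply/funext => h; rewrite /a /b /= addrA.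
Qed.

Lemma derivable_shift F x w v :
  derivable F (x + w) v -> derivable (fun y => F (y + w)) x v.
Proof.
rewrite /derivable.
set a := (X in cvg (X @ _) -> _); set b := (X in _ -> cvg (X @ _)).
suff -> : a = b by [].
by apply/funext => h; rewrite /a /b /= addrA.
Qed.

Lemma partial_mvt F x i (c : R) :
    (forall s : R, `|s| <= `|c| ->
      derivable F (x + s *: delta_mx 0 i) (delta_mx 0 i)) ->
  exists2 s, `|s| <= `|c| &
    F (x + c *: delta_mx 0 i) - F x = partial i F (x + s *: delta_mx 0 i) * c.
Proof.
move=> dF; set e := delta_mx 0 i in dF *.
pose phi s := F (x + s *: e).
have dphi (s : R) : `|s| <= `|c| ->
    is_derive s 1 phi (partial i F (x + s *: e)).
  by move=> /dF; apply: is_derive_line.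
have phi0 : phi 0 = F x by rewrite /phi scale0r addr0.
have cphi (a b : R) : (forall s, s \in `[a, b]%R -> `|s| <= `|c|) ->
    {within `[a, b], continuous phi}.
  move=> ab; apply: derivable_within_continuous => s /ab sc.
  by have [] := dphi s sc.
have [c0|c0] := leP 0 c.
- have ineq s : s \in `[0, c]%R -> `|s| <= `|c|.
    by rewrite in_itv /= => /andP[s0 sc]; rewrite !ger0_norm.
  have [s /ineq sc E] : exists2 s, s \in `[0, c]%R &
      phi c - phi 0 = partial i F (x + s *: e) * (c - 0).
    apply: (MVT_segment c0) (cphi _ _ ineq) => s /subset_itv_oo_cc /ineq.
    exact: dphi.
  by exists s => //; rewrite -phi0 -/(phi c) E subr0.
- have ineq s : s \in `[c, 0]%R -> `|s| <= `|c|.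
    rewrite in_itv /= => /andP[cs s0].
    by rewrite ler0_norm ?(ltr0_norm c0) ?lerN2.
  have [s /ineq sc E] : exists2 s, s \in `[c, 0]%R &
      phi 0 - phi c = partial i F (x + s *: e) * (0 - c).
    apply: (MVT_segment (ltW c0)) (cphi _ _ ineq) => s /subset_itv_oo_cc /ineq.
    exact: dphi.
  by exists s => //; rewrite -phi0 -/(phi c) -opprB E; ring.
Qed.

Lemma continuous_epsP F x : {for x, continuous F} <->
  forall e, 0 < e ->
    exists2 d, 0 < d & forall y, ball x d y -> `|F x - F y| < e.
Proof.
split.
  move=> /(@cvgrPdist_lt _ _ _ (nbhs x)) cF e e0.
  by have /nbhs_ballP[d d0 xd] := cF e e0; exists d.
move=> cF; apply/(@cvgrPdist_lt _ _ _ (nbhs x)) => e /cF[d d0 xd].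
by apply: filterS (nbhsx_ballx x d d0).
Qed.

(** The closed box with centre x and with y among its corners. It contains all
    the broken lines from x to y that follow coordinate directions. *)
Definition box x y : set 'rV[R]_n :=
  [set z | forall k, `|z 0 k - x 0 k| <= `|y 0 k - x 0 k|].

Lemma box_refl x z : box x x z -> z = x.
Proof.
move=> xz; apply/rowP => k; apply/eqP.
by have := xz k; rewrite subrr normr0 normr_le0 subr_eq0.
Qed.

Lemma box_ball x y z r : box x y z -> ball x r y -> ball x r z.
Proof.
move=> xyz [r0 xy]; split=> // i k; rewrite (ord1 i).
have := xy 0 k; rewrite /ball /= distrC => xyr; rewrite distrC.
exact: le_lt_trans (xyz k) xyr.
Qed.

(** Go from x to y by changing one coordinate at a time, and apply the mean
    value theorem on each segment. *)
Lemma hadamard F x y :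
    (forall z, box x y z -> forall i, derivable F z (delta_mx 0 i)) ->
  exists xi : 'I_n -> 'rV[R]_n, (forall i, box x y (xi i)) /\
    F y - F x = \sum_i partial i F (xi i) * (y 0 i - x 0 i).
Proof.
move=> dF.
pose z m : 'rV[R]_n := \row_k if (k < m)%N then y 0 k else x 0 k.
have zS (i : 'I_n) : z i.+1 = z i + (y 0 i - x 0 i) *: delta_mx 0 i.
  apply/rowP => k; rewrite !mxE eqxx /= ltnS leq_eqVlt.
  have [->|ki] := eqVneq k i; first by rewrite ltnn eqxx mulr1 addrC subrK.
  by rewrite (negbTE (_ : k != i :> nat)) ?mulr0 ?addr0.
have step (i : 'I_n) : exists w, box x y w /\
    F (z i.+1) - F (z i) = partial i F w * (y 0 i - x 0 i).
  have zbox s : `|s| <= `|y 0 i - x 0 i| -> box x y (z i + s *: delta_mx 0 i).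
    move=> sle k; rewrite !mxE eqxx /=.
    have [->|ki] := eqVneq k i; first by rewrite ltnn mulr1 addrAC subrr add0r.
    by rewrite mulr0 addr0; case: ifP => // _; rewrite subrr normr0.
  have [s /zbox sb E] :=
    @partial_mvt F (z i) i _ (fun s sle => dF _ (zbox s sle) i).
  by exists (z i + s *: delta_mx 0 i); rewrite zS.
have [xi xiP] := choice step.
exists xi; split=> [i|]; first by have [] := xiP i.
have -> : \sum_i partial i F (xi i) * (y 0 i - x 0 i) =
    \sum_(i < n) (F (z i.+1) - F (z i)).
  by apply: eq_bigr => i _; have [_ ->] := xiP i.
rewrite -(big_mkord predT (fun i => F (z i.+1) - F (z i))) telescope_sumr //.
by congr (F _ - F _); apply/rowP => k; rewrite mxE ?ltn_ord ?ltn0.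
Qed.

Lemma partial0_locally_constant U F x : open U -> U x ->
    (forall z, U z -> forall i, derivable F z (delta_mx 0 i)) ->
    (forall z, U z -> forall i, partial i F z = 0) ->
  \forall y \near x, F y = F x.
Proof.
move=> Uo Ux dF F0.
have /nbhs_ballP[r r0 rU] : nbhs x U by apply: open_nbhs_nbhs.
apply: filterS (nbhsx_ballx x r r0) => y xy.
have boxU z : box x y z -> U z by move=> xyz; apply/rU/(box_ball xyz).
have [xi [xib E]] := @hadamard F x y (fun z xyz => dF z (boxU z xyz)).
apply/eqP; rewrite -subr_eq0 E big1 // => i _.
by rewrite F0 ?mul0r //; apply: boxU.
Qed.

(** Total differentiability of a C^1 function, in the form that composes well:
    an exact expansion with coefficients that are continuous at x. *)
Lemma caratheodory U F x : open U -> U x -> Ck_on 1 U F ->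
  exists a : 'I_n -> 'rV[R]_n -> R,
    [/\ forall i, {for x, continuous (a i)},
        forall i, a i x = partial i F x
      & \forall y \near x, F y - F x = \sum_i a i y * (y 0 i - x 0 i)].
Proof.
move=> Uo Ux [_ CF].
have /nbhs_ballP[r r0 rU] : nbhs x U by apply: open_nbhs_nbhs.
have /choice[xi xiP] y : exists xi : 'I_n -> 'rV[R]_n, ball x r y ->
    (forall i, box x y (xi i)) /\
    F y - F x = \sum_i partial i F (xi i) * (y 0 i - x 0 i).
  have [xy|nxy] := pselect (ball x r y); last by exists (fun=> x).
  have boxU z : box x y z -> U z by move=> xyz; apply/rU/(box_ball xyz).
  have [xi xib] := @hadamard F x y (fun z xyz i => (CF i).1 z (boxU z xyz)).
  by exists xi.
have xix i : xi x i = x.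
  by apply: box_refl; have [] := xiP x (ballxx x r0).
exists (fun i y => partial i F (xi y i)); split.
- move=> i; apply/continuous_epsP => e e0; rewrite xix.
  have /continuous_epsP/(_ e e0)[d d0 xd] : {for x, continuous (partial i F)}.
    by have [_ [cF _]] := CF i; apply: cF.
  exists (Num.min d r) => [|y xy]; first by rewrite lt_min d0.
  have [xyd xyr] : ball x d y /\ ball x r y.
    by split; apply: le_ball xy; rewrite ge_min lexx ?orbT.
  by apply: xd; have [yb _] := xiP y xyr; apply: box_ball (yb i) xyd.
- by move=> i; rewrite xix.
- by apply: filterS (nbhsx_ballx x r r0) => y /xiP[].
Qed.

End MeanValue.

Section SecondOrder.
Variables (R : realType) (n : nat).
Implicit Types (U : set 'rV[R]_n) (F : 'rV[R]_n -> R).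

(** The second difference of F over a square of side t, by two applications of
    the mean value theorem. The factor t + t bounds the distance to x of every
    point of the square. *)
Lemma second_difference U F x r (t : R) i j : smooth_on U F ->
    ball x r `<=` U -> 0 < t -> t + t < r ->
  exists2 z, ball x r z &
    F (x + t *: delta_mx 0 i + t *: delta_mx 0 j) - F (x + t *: delta_mx 0 i)
      - (F (x + t *: delta_mx 0 j) - F x)
    = partial j (partial i F) z * t * t.
Proof.
move=> sF rU t0 tr; set e := delta_mx 0 i; set e' := delta_mx 0 j.
have inball s s' : `|s| <= `|t| -> `|s'| <= `|t| ->
    ball x r (x + s *: e + s' *: e').
  rewrite (gtr0_norm t0) => st s't; split=> [|a b]; first by lra.
  rewrite (ord1 a) /ball /= !mxE eqxx /= -addrA opprD addrA subrr sub0r normrN.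
  apply: le_lt_trans tr; apply: le_trans (ler_normD _ _) _.
  apply: lerD; rewrite normrM normr_nat.
    by apply: le_trans st; rewrite ler_piMr ?lern1 ?leq_b1.
  by apply: le_trans s't; rewrite ler_piMr ?lern1 ?leq_b1.
have t1 : `|t| <= `|t| by [].
have z1 : `|0 : R| <= `|t| by rewrite normr0.
pose G y := F (y + t *: e') - F y.
have dF s s' : `|s| <= `|t| -> `|s'| <= `|t| ->
    derivable F (x + s *: e + s' *: e') e.
  by move=> st s't; apply: (smooth_on_derivable sF); apply/rU/inball.
have dF0 s : `|s| <= `|t| -> derivable F (x + s *: e) e.
  by move=> st; have := dF s 0 st z1; rewrite scale0r addr0.
have dG s : `|s| <= `|t| -> derivable G (x + s *: e) e.
  move=> st; apply: derivableB; last exact: dF0.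
  by apply: derivable_shift; apply: dF.
have [s st E] := partial_mvt dG.
have sFi := smooth_on_partial i sF.
have dFi s' : `|s'| <= `|t| ->
    derivable (partial i F) (x + s *: e + s' *: e') e'.
  by move=> s't; apply: (smooth_on_derivable sFi); apply/rU/inball.
have [s' s't E'] := partial_mvt dFi.
exists (x + s *: e + s' *: e'); first exact: inball.
rewrite -[LHS]/(G (x + t *: e) - G x) E; congr (_ * _).
rewrite -E' -(partial_shift F) /partial deriveB //; last exact: dF0.
by apply: derivable_shift; apply: dF.
Qed.

Let dist_le (a b c e : R) :
  `|a - c| < e / 2 -> `|b - c| < e / 2 -> `|a - b| <= e.
Proof.
move=> ac bc; rewrite -(subrKA c) (splitr e); apply: le_trans (ler_normD _ _) _.
by rewrite ltW // ltrD // distrC.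
Qed.

(** The second difference is symmetric in the two directions, so by
    [second_difference] the two mixed derivatives agree at points that are
    arbitrarily close to x; conclude by continuity. *)
Lemma partialC U F x i j : open U -> smooth_on U F -> U x ->
  partial i (partial j F) x = partial j (partial i F) x.
Proof.
move=> Uo sF Ux; apply/eqP; rewrite -subr_eq0 -normr_eq0; apply/eqP/le_anti.
rewrite normr_ge0 andbT; apply/ler_addgt0Pr => e e0; rewrite add0r.
have /nbhs_ballP[r r0 rU] : nbhs x U by apply: open_nbhs_nbhs.
have cont k l : {for x, continuous (partial k (partial l F))}.
  have s := smooth_on_partial k (smooth_on_partial l sF).
  exact: Ck_on_continuous (s 0%N) Ux.
have e2 : 0 < e / 2 by rewrite divr_gt0.
have /continuous_epsP/(_ _ e2)[d d0 xd] := cont i j.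
have /continuous_epsP/(_ _ e2)[d' d'0 xd'] := cont j i.
pose q := Num.min r (Num.min d d').
have q0 : 0 < q by rewrite !lt_min r0 d0.
have qU : ball x q `<=` U.
  by move=> z xz; apply: rU; apply: le_ball xz; rewrite ge_min lexx.
pose t := q / 3; have t0 : 0 < t by rewrite divr_gt0.
have tq : t + t < q by rewrite /t; lra.
have [z xz E] := second_difference i j sF qU t0 tq.
have [z' xz' E'] := second_difference j i sF qU t0 tq.
have zz' : partial i (partial j F) z' = partial j (partial i F) z.
  apply: (mulIf (lt0r_neq0 t0)); apply: (mulIf (lt0r_neq0 t0)).
  apply: (etrans (esym E')); apply: etrans E.
  rewrite (addrAC x (t *: delta_mx 0 j)).
  by move: (F _) (F _) (F _) (F _) => *; ring.
have xdz' : `|partial i (partial j F) x - partial i (partial j F) z'| < e / 2.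
  by apply: xd; apply: le_ball xz'; rewrite !ge_min lexx !orbT.
have xdz : `|partial j (partial i F) x - partial j (partial i F) z| < e / 2.
  by apply: xd'; apply: le_ball xz; rewrite !ge_min lexx !orbT.
by rewrite zz' in xdz'; apply: dist_le xdz' xdz.
Qed.

End SecondOrder.

Section ChainRule.
Variables (R : realType) (n p : nat).

(** Substitute Psi into the expansion given by [caratheodory] and divide by the
    increment: each coefficient tends to a partial derivative of F. *)
Lemma chain_rule (U : set 'rV[R]_n) (F : 'rV[R]_n -> R)
    (Psi : 'rV[R]_p -> 'rV[R]_n) x i :
    open U -> U (Psi x) -> Ck_on 1 U F -> {for x, continuous Psi} ->
    (forall k, derivable (fun y => Psi y 0 k) x (delta_mx 0 i)) ->
  partial i (F \o Psi) x =
    \sum_k partial k F (Psi x) * partial i (fun y => Psi y 0 k) x.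
Proof.
move=> Uo UPsi CF cPsi dPsi.
have [a [ca ax aE]] := caratheodory Uo UPsi CF.
pose line (h : R) := h *: delta_mx 0 i + x : 'rV[R]_p.
have cline : line h @[h --> 0^'] --> x.
  have line0 : line h @[h --> (0 : R)] --> line 0.
    by apply: cvgD; [exact: scalel_continuous|exact: cvg_cst].
  rewrite /line scale0r add0r in line0.
  by apply: cvg_trans line0; apply: cvg_app; apply: cvg_within.
have cPsiline : Psi (line h) @[h --> 0^'] --> Psi x.
  exact: cvg_comp cline cPsi.
rewrite /partial /derive; apply: cvg_lim => //.
have lim : (\sum_k a k (Psi (line h)) *
    (h^-1 *: (Psi (line h) 0 k - Psi x 0 k))) @[h --> 0^'] -->
    \sum_k partial k F (Psi x) * partial i (fun y => Psi y 0 k) x.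
  apply: cvg_big => [|k _]; first exact: add_continuous.
  apply: cvgM; last exact: dPsi.
  by rewrite -ax; apply: cvg_comp cPsiline (ca k).
have E : \forall h \near 0^', \sum_k a k (Psi (line h)) *
    (h^-1 *: (Psi (line h) 0 k - Psi x 0 k)) =
    h^-1 *: (((F \o Psi) \o shift x) (h *: delta_mx 0 i) - (F \o Psi) x).
  have : \forall h \near 0^', F (Psi (line h)) - F (Psi x) =
      \sum_k a k (Psi (line h)) * (Psi (line h) 0 k - Psi x 0 k).
    exact: cPsiline _ aE.
  apply: filterS => h E.
  rewrite /= -/(line h) E scaler_sumr; apply: eq_bigr => k _.
  by rewrite scalerAr.
exact: cvg_trans (near_eq_cvg E) lim.
Qed.

End ChainRule.

(** * The ring of smooth functions on an open set *)

(** Only values on U are meaningful; requiring the value 0 elsewhere makes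
    Leibniz equality coincide with equality on U. *)
Record sfun (R : realType) (n : nat) (U : set 'rV[R]_n) (Uo : open U) := SFun {
  sfun_val :> 'rV[R]_n -> R;
  sfun_smooth : smooth_on U sfun_val;
  sfun_out : forall x, ~ U x -> sfun_val x = 0
}.

Section SmoothRing.
Variables (R : realType) (n : nat) (U : set 'rV[R]_n) (Uo : open U).
Implicit Types (F G : 'rV[R]_n -> R) (a b c : sfun Uo).

(** This is why the ring axioms hold on the nose, with no quotient. *)
Lemma sfun_ext a b : (forall x, U x -> a x = b x) -> a = b.
Proof.
move=> ab; have {ab} : sfun_val a = sfun_val b.
  apply/funext => x; have [/ab //|nUx] := pselect (U x).
  by rewrite !sfun_out.
case: a b => F sF F0 [G sG G0] /= E; subst G.
by congr (SFun Uo); apply: Prop_irrelevance.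
Qed.

Definition cutoff F x : R := if `[< U x >] then F x else 0.

Lemma cutoffE F x : U x -> cutoff F x = F x.
Proof. by rewrite /cutoff => Ux; case: asboolP. Qed.

Lemma cutoff_out F x : ~ U x -> cutoff F x = 0.
Proof. by rewrite /cutoff => nUx; case: asboolP. Qed.

Lemma cutoff_smooth F : smooth_on U F -> smooth_on U (cutoff F).
Proof.
move=> sF k; by apply: Ck_on_ext (sF k) => // x Ux; rewrite cutoffE.
Qed.

Definition mk_sfun F (sF : smooth_on U F) : sfun Uo :=
  SFun Uo (cutoff_smooth sF) (@cutoff_out F).

Lemma smooth_onD F G : smooth_on U F -> smooth_on U G -> smooth_on U (F + G).
Proof. by move=> sF sG k; apply: Ck_onD. Qed.

Lemma smooth_onM F G : smooth_on U F -> smooth_on U G -> smooth_on U (F * G).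
Proof. by move=> sF sG k; apply: Ck_onM. Qed.

Lemma smooth_on_cst t : smooth_on U (cst t).
Proof. by move=> k; apply: Ck_on_cst. Qed.

Lemma smooth_onV F : (forall x, U x -> F x != 0) ->
  smooth_on U F -> smooth_on U (fun x => (F x)^-1).
Proof. by move=> F0 sF k; apply: Ck_onV. Qed.

Definition sfun_add a b := mk_sfun (smooth_onD (sfun_smooth a) (sfun_smooth b)).
Definition sfun_mul a b := mk_sfun (smooth_onM (sfun_smooth a) (sfun_smooth b)).
Definition sfun_cst t := mk_sfun (smooth_on_cst t).
Definition sfun_opp a := sfun_mul (sfun_cst (-1)) a.

Let addE a b x : U x -> sfun_add a b x = a x + b x.
Proof. by move=> Ux; rewrite /= cutoffE. Qed.
Let mulE a b x : U x -> sfun_mul a b x = a x * b x.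
Proof. by move=> Ux; rewrite /= cutoffE. Qed.
Let cstE t x : U x -> sfun_cst t x = t.
Proof. by move=> Ux; rewrite /= cutoffE. Qed.

HB.instance Definition _ := gen_eqMixin (sfun Uo).
HB.instance Definition _ := gen_choiceMixin (sfun Uo).

Fact sfun_addA : associative sfun_add.
Proof. by move=> a b c; apply: sfun_ext => x Ux; rewrite !addE// addrA. Qed.
Fact sfun_addC : commutative sfun_add.
Proof. by move=> a b; apply: sfun_ext => x Ux; rewrite !addE// addrC. Qed.
Fact sfun_add0 : left_id (sfun_cst 0) sfun_add.
Proof. by move=> a; apply: sfun_ext => x Ux; rewrite addE// cstE// add0r. Qed.
Fact sfun_addN : left_inverse (sfun_cst 0) sfun_opp sfun_add.
Proof.
move=> a; apply: sfun_ext => x Ux.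
by rewrite addE// mulE// !cstE// mulN1r addNr.
Qed.
HB.instance Definition _ :=
  GRing.isZmodule.Build (sfun Uo) sfun_addA sfun_addC sfun_add0 sfun_addN.

Fact sfun_mulA : associative sfun_mul.
Proof. by move=> a b c; apply: sfun_ext => x Ux; rewrite !mulE// mulrA. Qed.
Fact sfun_mulC : commutative sfun_mul.
Proof. by move=> a b; apply: sfun_ext => x Ux; rewrite !mulE// mulrC. Qed.
Fact sfun_mul1 : left_id (sfun_cst 1) sfun_mul.
Proof. by move=> a; apply: sfun_ext => x Ux; rewrite mulE// cstE// mul1r. Qed.
Fact sfun_mulD : left_distributive sfun_mul +%R.
Proof.
move=> a b c; apply: sfun_ext => x Ux.
by rewrite [RHS]addE// !mulE// -mulrDl; congr (_ * _); apply: addE.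
Qed.
HB.instance Definition _ := GRing.Zmodule_isComPzRing.Build (sfun Uo)
  sfun_mulA sfun_mulC sfun_mul1 sfun_mulD.

Section Evaluation.
Variables (x : 'rV[R]_n) (Ux : U x).

Definition sfun_ev of U x := fun a : sfun Uo => a x.

Fact sfun_ev_additive : nmod_morphism (sfun_ev Ux).
Proof. by split=> [|a b]; [apply: cstE|apply: addE]. Qed.
Fact sfun_ev_multiplicative : monoid_morphism (sfun_ev Ux).
Proof. by split=> [|a b]; [apply: cstE|apply: mulE]. Qed.
HB.instance Definition _ :=
  GRing.isNmodMorphism.Build (sfun Uo) R (sfun_ev Ux) sfun_ev_additive.
HB.instance Definition _ :=
  GRing.isMonoidMorphism.Build (sfun Uo) R (sfun_ev Ux) sfun_ev_multiplicative.

End Evaluation.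

Definition sfun_partial i a : sfun Uo :=
  mk_sfun (smooth_on_partial i (@sfun_smooth _ _ _ _ a)).

Lemma sfun_partialE i a x : U x -> sfun_partial i a x = partial i a x.
Proof. by move=> Ux; rewrite /= cutoffE. Qed.

Lemma sfun0E x : U x -> (0 : sfun Uo) x = 0.
Proof. exact: cstE. Qed.

Lemma sfun_partial_mk i F (sF : smooth_on U F) x : U x ->
  sfun_partial i (mk_sfun sF) x = partial i F x.
Proof.
move=> Ux; rewrite sfun_partialE //.
by apply: (partial_ext _ Uo) => // y; apply: cutoffE.
Qed.

Let derivable_sfun a i x : U x -> derivable a x (delta_mx 0 i).
Proof. exact/smooth_on_derivable/sfun_smooth. Qed.

Fact sfun_partial_additive i : nmod_morphism (sfun_partial i).
Proof.
split=> [|a b]; apply: sfun_ext => x Ux.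
  by rewrite sfun_partial_mk // cstE // /partial derive_cst.
rewrite [RHS]addE // sfun_partial_mk // !sfun_partialE // /partial.
by rewrite deriveD //; apply: derivable_sfun.
Qed.
HB.instance Definition _ i := GRing.isNmodMorphism.Build (sfun Uo) (sfun Uo)
  (sfun_partial i) (sfun_partial_additive i).

Lemma sfun_partialM i a b :
  sfun_partial i (a * b) = sfun_partial i a * b + a * sfun_partial i b.
Proof.
apply: sfun_ext => x Ux; rewrite sfun_partial_mk // [RHS]addE // !mulE //.
rewrite !sfun_partialE // /partial deriveM; [|exact: derivable_sfun..].
by rewrite addrC [_ *: 'D__ a x]mulrC.
Qed.

Lemma sfun_partialC i j a :
  sfun_partial i (sfun_partial j a) = sfun_partial j (sfun_partial i a).
Proof.
apply: sfun_ext => x Ux.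
have iterE k l :
    sfun_partial k (sfun_partial l a) x = partial k (partial l a) x.
  exact: (sfun_partial_mk k (smooth_on_partial l (sfun_smooth a)) Ux).
apply: (etrans (iterE i j)); apply: (etrans _ (esym (iterE j i))).
exact: partialC Uo (@sfun_smooth _ _ _ _ a) Ux.
Qed.

Lemma sfun_partial_cst i t : sfun_partial i (sfun_cst t) = 0.
Proof.
apply: sfun_ext => x Ux.
by rewrite sfun_partial_mk // cstE // /partial derive_cst.
Qed.

Lemma sfun_half : sfun_cst 2^-1 + sfun_cst 2^-1 = 1.
Proof.
apply: sfun_ext => x Ux; rewrite [LHS]addE // [RHS]cstE // cstE //.
by rewrite [RHS]splitr div1r.
Qed.

Lemma sfun_inv a : (forall x, U x -> a x != 0) -> exists b, b * a = 1.
Proof.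
move=> a0; exists (mk_sfun (smooth_onV a0 (@sfun_smooth _ _ _ _ a))).
apply: sfun_ext => x Ux; rewrite [LHS]mulE // [RHS]cstE //= cutoffE //.
by rewrite mulVf ?a0.
Qed.

End SmoothRing.

(** * Tensor fields in a chart as elements of the ring *)

Lemma posdef_unitmx (R : realFieldType) n (M : 'M[R]_n) :
  (forall v : 'rV_n, v != 0 -> 0 < (v *m M *m v^T) 0 0) -> M \in unitmx.
Proof.
move=> Mpos; rewrite -row_free_unit -kermx_eq0.
apply/rowV0P => v /sub_kermxP vM.
apply/eqP/negPn/negP => /Mpos.
by rewrite vM mul0mx mxE ltxx.
Qed.

Section Frame.
Variables (R : realType) (n : nat) (B : manifold R n).
Variables (a : chart_index B) (O : set B).
Hypotheses (Oo : open O) (Oa : O `<=` dom (atlas a)).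

Local Notation chi := (cmap (atlas a)).
Local Notation W := (chi @` O).

(** The image of O is its preimage by the inverse chart, within the image of
    the chart. *)
Lemma chart_image_open : open W.
Proof.
rewrite openE => _ [q Oq <-].
have iq : img (atlas a) (chi q) by exists q => //; apply: Oa.
have nO : \forall y \near chi q, O (cinv (atlas a) y).
  apply: (cinv_continuous iq); rewrite cmapK; last exact: Oa.
  exact: open_nbhs_nbhs.
have ni : \forall y \near chi q, img (atlas a) y.
  by apply: open_nbhs_nbhs; split=> //; apply: img_open.
apply: filterS2 nO ni => y Oy [q' dq' yE]; exists q' => //.
by rewrite -(cmapK dq') yE.
Qed.

Local Notation S := (sfun chart_image_open).

Definition ev_at (p : B) (Op : O p) : S -> R :=
  sfun_ev (Uo := chart_image_open) (imageP chi Op).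
HB.instance Definition _ p Op := GRing.RMorphism.on (@ev_at p Op).

(** The function v on the manifold, restricted to O and read in the chart a, is
    the ring element V. All the operators of the theorem preserve this
    relation, so that identities in the ring become identities on O. *)
Definition represents (v : B -> R) (V : S) : Prop :=
  forall p (Op : O p), v p = ev_at Op V.

Lemma represents_smooth_on v :
  smooth_on W (v \o cinv (atlas a)) -> exists V, represents v V.
Proof.
move=> sW; exists (mk_sfun chart_image_open sW) => p Op.
rewrite /ev_at /sfun_ev /= cutoffE /=; last by exists p.
by rewrite cmapK //; apply: Oa.
Qed.

Lemma represents_smooth v :
  smooth_on (img (atlas a)) (v \o cinv (atlas a)) -> exists V, represents v V.
Proof.
move=> sv; apply: represents_smooth_on => k.
apply: Ck_on_sub (sv k) => _ [p Op <-].
by exists p => //; apply: Oa.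
Qed.

Lemma represents_cst t : represents (fun=> t) (sfun_cst chart_image_open t).
Proof. by move=> p Op; rewrite /ev_at /sfun_ev /= cutoffE //; exists p. Qed.

Lemma represents_inj V V' :
  (forall p (Op : O p), ev_at Op V = ev_at Op V') -> V = V'.
Proof. by move=> VV'; apply: sfun_ext => _ [p Op <-]; apply: VV'. Qed.

Lemma represents_inj_mx k l (M N : 'M[S]_(k, l)) :
  (forall p (Op : O p), map_mx (ev_at Op) M = map_mx (ev_at Op) N) -> M = N.
Proof.
move=> MN; apply/matrixP => i j; apply: represents_inj => p Op.
by have /matrixP/(_ i j) := MN p Op; rewrite !mxE.
Qed.

Definition chart_d (i : 'I_n) : {additive S -> S} := sfun_partial i.

Lemma represents_pd i v V :
  represents v V -> represents (pd a i v) (chart_d i V).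
Proof.
move=> vV p Op; have Wp : W (chi p) by exists p.
rewrite /ev_at /sfun_ev sfun_partialE //.
apply: (partial_ext _ chart_image_open) => // _ [q Oq <-].
by rewrite /= cmapK; [exact: vV|exact: Oa].
Qed.

(** Constancy near a point of the chart image is pulled back by the continuous
    chart map. *)
Lemma represents_locally_constant v V :
  represents v V -> (forall i, chart_d i V = 0) ->
  forall p, O p -> \forall q \near p, v q = v p.
Proof.
move=> vV V0 p Op; have Wp : W (chi p) by exists p.
have Vc : \forall y \near chi p, V y = V (chi p).
  apply: (partial0_locally_constant chart_image_open) => // z Wz i.
    exact: smooth_on_derivable (sfun_smooth V) Wz.
  rewrite -(sfun_partialE i V Wz); have -> : sfun_partial i V = 0 := V0 i.
  exact: sfun0E.
have {}Vc : \forall q \near p, V (chi q) = V (chi p).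
  exact: (cmap_continuous (Oa Op)) _ Vc.
apply: filterS2 Vc (open_nbhs_nbhs (conj Oo Op)) => q Vq Oq.
by rewrite (vV q Oq) (vV p Op).
Qed.

Variable g : riemannian_metric B.

Lemma metric_unitmx p : dom (atlas a) p -> g a p \in unitmx.
Proof. by move=> dp; apply: posdef_unitmx; apply: metric_posdef dp. Qed.

(** The inverse metric lives in the ring: it is the adjugate of the metric
    divided by its determinant, which does not vanish. *)
Lemma metric_represents : exists G H : 'M[S]_n,
  (forall i j, represents (fun p => g a p i j) (G i j)) /\ H *m G = 1%:M.
Proof.
have /choice[G GP] (ij : 'I_n * 'I_n) :
    exists V, represents (fun p => g a p ij.1 ij.2) V.
  by apply: represents_smooth; apply: metric_smooth.
pose M : 'M[S]_n := \matrix_(i, j) G (i, j).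
have MP i j : represents (fun p => g a p i j) (M i j).
  by rewrite mxE; apply: (GP (i, j)).
have evM p (Op : O p) : map_mx (ev_at Op) M = g a p.
  by apply/matrixP => i j; rewrite [LHS]mxE -MP.
have [d dM] : exists d, d * \det M = 1.
  apply: sfun_inv => _ [p Op <-]; rewrite -[X in X != 0]/(ev_at Op (\det M)).
  by rewrite -det_map_mx evM -unitfE -unitmxE metric_unitmx //; apply: Oa.
exists M, (d *: \adj M); split=> //.
by rewrite -scalemxAl mul_adj_mx scale_scalar_mx dM.
Qed.

Variables (G H : 'M[S]_n).
Hypothesis GP : forall i j, represents (fun p => g a p i j) (G i j).
Hypothesis HG : H *m G = 1%:M.

Lemma metric_model_sym : G^T = G.
Proof.
apply/matrixP => i j; rewrite mxE; apply: represents_inj => p Op.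
by rewrite -!GP -[in RHS](Defs.metric_sym g (Oa Op)) mxE.
Qed.

Lemma ev_metric p (Op : O p) : map_mx (ev_at Op) G = g a p.
Proof. by apply/matrixP => i j; rewrite [LHS]mxE -GP. Qed.

Lemma ev_inverse p (Op : O p) : map_mx (ev_at Op) H = invmx (g a p).
Proof.
have gu := metric_unitmx (Oa Op).
by rewrite -[LHS](mulmxK gu) -{1}(ev_metric Op) -map_mxM HG map_mx1 mul1mx.
Qed.

Lemma represents_inverse i j : represents (fun p => invmx (g a p) i j) (H i j).
Proof. by move=> p Op; rewrite -(ev_inverse Op) mxE. Qed.

Local Notation half := (sfun_cst chart_image_open 2^-1).

Lemma represents_christoffel k i j :
  represents (christoffel g a k i j) (chr chart_d half G H k i j).
Proof.
move=> p Op; apply: etrans (esym (rmorph_chr _ _ _ _ _ _ _ _)).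
rewrite /christoffel.
congr (_ * _); first exact: represents_cst.
apply: eq_bigr => l _.
congr (_ * (_ + _ - _)); first exact: represents_inverse.
- exact: represents_pd (GP j l) p Op.
- exact: represents_pd (GP i l) p Op.
- exact: represents_pd (GP i j) p Op.
Qed.

Lemma represents_ricci i j :
  represents (fun p => ricci g a p i j) (ric chart_d half G H i j).
Proof.
move=> p Op; apply: etrans (esym (rmorph_ric _ _ _ _ _ _ _)).
rewrite mxE; apply: eq_bigr => k _; congr (_ - _ + _).
- exact: represents_pd (represents_christoffel k i j) p Op.
- exact: represents_pd (represents_christoffel k k j) p Op.
- apply: eq_bigr => s _.
  by congr (_ * _ - _ * _); apply: represents_christoffel.
Qed.

Lemma ev_ric p (Op : O p) :
  map_mx (ev_at Op) (ric chart_d half G H) = ricci g a p.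
Proof.
apply/matrixP => i j; rewrite [LHS]mxE.
by apply/esym; apply: (represents_ricci i j).
Qed.

Lemma represents_hessian u V i j : represents u V ->
  represents (fun p => hessian g a u p i j) (hess chart_d half G H V i j).
Proof.
move=> uV p Op; apply: etrans (esym (rmorph_hess _ _ _ _ _ _ _ _)).
rewrite mxE; congr (_ - _).
  by have /(_ p Op) := represents_pd i (represents_pd j uV).
apply: eq_bigr => k _; congr (_ * _); first exact: represents_christoffel.
exact: represents_pd.
Qed.

Lemma ev_hess u V p (Op : O p) : represents u V ->
  map_mx (ev_at Op) (hess chart_d half G H V) = hessian g a u p.
Proof.
move=> uV; apply/matrixP => i j; rewrite [LHS]mxE.
by apply/esym; apply: (represents_hessian i j uV).
Qed.

Lemma represents_laplacian u V : represents u V ->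
  represents (laplacian g a u) (lap chart_d half G H V).
Proof.
move=> uV p Op; apply: etrans (esym (rmorph_lap _ _ _ _ _ _)).
by rewrite (ev_hess _ uV) ev_inverse.
Qed.

Definition differential (u : B -> R) (p : B) : 'rV[R]_n := \row_i pd a i u p.

Lemma ev_dif u V p (Op : O p) : represents u V ->
  map_mx (ev_at Op) (dif chart_d V) = differential u p.
Proof.
by move=> uV; apply/rowP => i; rewrite !mxE; apply/esym/represents_pd.
Qed.

(** In this form, inner products of gradients involve differentials and the
    inverse metric only. *)
Lemma grad_innerE u v p : dom (atlas a) p ->
  grad_inner g a u v p =
  (differential u p *m invmx (g a p) *m (differential v p)^T) 0 0.
Proof.
move=> dp; have gT := Defs.metric_sym g dp.
have gradE w : grad g a w p = differential w p *m invmx (g a p).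
  rewrite -[RHS]trmxK trmx_mul trmx_inv gT; apply/rowP => i; rewrite !mxE.
  by apply: eq_bigr => j _; rewrite !mxE.
rewrite /grad_inner /inner !gradE trmx_mul trmx_inv gT mulmxKV ?mulmxA //.
exact: metric_unitmx.
Qed.

Lemma represents_grad_inner u v V V' : represents u V -> represents v V' ->
  represents (grad_inner g a u v) (gdot chart_d H V V').
Proof.
move=> uV vV' p Op; rewrite grad_innerE; last exact: Oa.
rewrite -(ev_dif Op uV) -(ev_dif Op vV') -(ev_inverse Op).
exact: esym (rmorph_gdot _ _ _ _ _).
Qed.

Lemma hessian_grad w u v F U V p :
    represents w F -> represents u U -> represents v V -> O p ->
  (differential u p *m invmx (g a p) *m hessian g a w p *m invmx (g a p)
     *m (differential v p)^T) 0 0 * 2 =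
  grad_inner g a u (grad_inner g a w v) p
  + grad_inner g a v (grad_inner g a w u) p
  - grad_inner g a w (grad_inner g a u v) p.
Proof.
move=> wF uU vV Op.
have := rmorph_hess_gdot (@sfun_partialM _ _ _ chart_image_open)
  (@sfun_partialC _ _ _ chart_image_open) (sfun_half _) metric_model_sym HG
  (ev_at Op) F U V.
rewrite (ev_hess Op wF) (ev_dif Op uU) (ev_dif Op vV) (ev_inverse Op) => ->.
have r1 := represents_grad_inner uU (represents_grad_inner wF vV).
have r2 := represents_grad_inner vV (represents_grad_inner wF uU).
have r3 := represents_grad_inner wF (represents_grad_inner uU vV).
by congr (_ + _ - _); apply/esym; [exact: r1|exact: r2|exact: r3].
Qed.

End Frame.

(** * Independence of the chart *)

Local Opaque grad_inner laplacian.

Section ChartChange.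
Variables (R : realType) (n : nat) (B : manifold R n) (a b : chart_index B).

Local Notation O := (dom (atlas a) `&` dom (atlas b)).

Lemma overlap_open : open O.
Proof. by apply: openI; apply: dom_open. Qed.

Local Notation Oa := (@subIsetl _ (dom (atlas a)) (dom (atlas b))).
Local Notation Ob := (@subIsetr _ (dom (atlas a)) (dom (atlas b))).
Local Notation Wa := (chart_image_open overlap_open Oa).
Local Notation Wb := (chart_image_open overlap_open Ob).
(* Smoothness of u on the overlap, read in each of the two charts. *)
Local Notation represented u :=
  ((exists V, represents (Oo := overlap_open) (Oa := Oa) u V) /\
   (exists V, represents (Oo := overlap_open) (Oa := Ob) u V)).

(** The chain rule for the transition map. *)
Lemma pd_change u p i : represented u -> O p ->
  pd a i u p = \sum_k pd b k u p * transition_jac a b p k i.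
Proof.
move=> [_ [V uV]] Op; have [ap bp] := Op.
pose x := cmap (atlas a) p.
pose Psi := cmap (atlas b) \o cinv (atlas a).
have Wx : [set cmap (atlas a) q | q in O] x by exists p.
have Psix : Psi x = cmap (atlas b) p by rewrite /Psi /= cmapK.
have Wy : [set cmap (atlas b) q | q in O] (Psi x) by rewrite Psix; exists p.
have -> : pd a i u p = partial i (V \o Psi) x.
  apply: (partial_ext _ Wa) => // _ [q Oq <-].
  by rewrite /Psi /= cmapK ?(uV q Oq) //; case: Oq.
rewrite (@chain_rule _ _ _ _ V Psi x i Wb Wy).
- apply: eq_bigr => k _; rewrite mxE; congr (_ * _).
  have e : pd b k u p = sfun_partial k V (cmap (atlas b) p).
    exact: (represents_pd k uV).
  by rewrite e Psix sfun_partialE //; exists p.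
- exact: sfun_smooth.
- apply: continuous_comp; first by apply: cinv_continuous; exists p.
  by rewrite cmapK //; apply: cmap_continuous.
- move=> k; exact: smooth_on_derivable (atlas_smooth a b k) Wx.
Qed.

Lemma differential_change u p : represented u -> O p ->
  differential a u p = differential b u p *m transition_jac a b p.
Proof.
move=> ru Op; apply/rowP => i; rewrite !mxE pd_change //.
by apply: eq_bigr => k _; rewrite !mxE.
Qed.

Lemma coord_represented k : represented (fun q => cmap (atlas b) q 0 k).
Proof.
split; first exact: represents_smooth_on (atlas_smooth a b k).
by apply: represents_smooth; have := atlas_smooth b b k; rewrite setIid.
Qed.

Variable g : riemannian_metric B.

Lemma jac_unitmx p : O p -> transition_jac a b p \in unitmx.
Proof.
move=> [ap bp]; have := metric_unitmx g ap.
by rewrite (metric_tensor g ap bp) unitmx_mul => /andP[].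
Qed.

Lemma inverse_metric_change p : O p ->
  transition_jac a b p *m invmx (g a p) *m (transition_jac a b p)^T
  = invmx (g b p).
Proof.
move=> Op; have [ap bp] := Op; have Ju := jac_unitmx Op.
have gu := metric_unitmx g bp; have gau := metric_unitmx g ap.
apply: (can_inj (mulmxK gu)); rewrite mulVmx //.
apply: (can_inj (mulmxK Ju)); rewrite mul1mx.
set J := transition_jac a b p.
have -> : J *m invmx (g a p) *m J^T *m g b p *m J =
    J *m (invmx (g a p) *m (J^T *m g b p *m J)) by rewrite !mulmxA.
by rewrite -(metric_tensor g ap bp) mulVmx // mulmx1.
Qed.

Lemma grad_inner_change u v p : represented u -> represented v -> O p ->
  grad_inner g a u v p = grad_inner g b u v p.
Proof.
move=> ru rv Op; have [ap bp] := Op.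
rewrite !grad_innerE // (differential_change ru Op) (differential_change rv Op).
rewrite trmx_mul.
by rewrite -(inverse_metric_change Op) !mulmxA.
Qed.

Lemma grad_inner_represented u v : represented u -> represented v ->
  represented (grad_inner g a u v).
Proof.
move=> ru rv; have [[U uU] [U' uU']] := ru; have [[V vV] [V' vV']] := rv.
have [G [H [GP HG]]] := metric_represents overlap_open Oa g.
have [G' [H' [GP' HG']]] := metric_represents overlap_open Ob g.
split.
  exists (gdot (@chart_d _ _ _ _ _ _ _) H U V).
  exact: represents_grad_inner.
exists (gdot (@chart_d _ _ _ _ _ _ _) H' U' V') => p Op.
apply: (etrans (grad_inner_change ru rv Op)).
exact: (represents_grad_inner GP' HG').
Qed.

(** By [hessian_grad] both sides are combinations of iterated inner products of
    gradients, which do not depend on the chart by [grad_inner_change]. *)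
Lemma hessian_change u v w p :
    represented u -> represented v -> represented w -> O p ->
  (differential a u p *m invmx (g a p) *m hessian g a w p *m invmx (g a p)
     *m (differential a v p)^T) 0 0 =
  (differential b u p *m invmx (g b p) *m hessian g b w p *m invmx (g b p)
     *m (differential b v p)^T) 0 0.
Proof.
move=> ru rv rw Op; have [[U uU] [U' uU']] := ru; have [[V vV] [V' vV']] := rv.
have [[F wF] [F' wF']] := rw.
have [G [H [GP HG]]] := metric_represents overlap_open Oa g.
have [G' [H' [GP' HG']]] := metric_represents overlap_open Ob g.
have iter x y z : represented x -> represented y -> represented z ->
    grad_inner g a x (grad_inner g a y z) p =
    grad_inner g b x (grad_inner g b y z) p.
  move=> rx ry rz; have ryz := grad_inner_represented ry rz.
  apply: (etrans (grad_inner_change rx ryz Op)).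
  have [[_ _] [X xX]] := rx; have [_ [Z zZ]] := ryz.
  have zZ' : represents (Oo := overlap_open) (Oa := Ob) (grad_inner g b y z) Z.
    move=> q Oq; apply: (etrans (esym (grad_inner_change ry rz Oq))).
    exact: zZ.
  apply: (etrans (represents_grad_inner GP' HG' xX zZ Op)).
  exact: esym (represents_grad_inner GP' HG' xX zZ' Op).
apply: (mulIf (_ : 2 != 0 :> R)); first by rewrite pnatr_eq0.
rewrite (hessian_grad GP HG wF uU vV Op) (hessian_grad GP' HG' wF' uU' vV' Op).
have congrDB (x y z x' y' z' : R) :
    x = x' -> y = y' -> z = z' -> x + y - z = x' + y' - z' by move=> -> -> ->.
exact: (congrDB _ _ _ _ _ _ (iter u w v ru rw rv) (iter v w u rv rw ru)
  (iter w u v rw ru rv)).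
Qed.

(** Evaluated on the gradients of the coordinate functions of the chart b,
    [hessian_change] says that the Hessian with raised indices transforms by the
    Jacobian on both sides; the metric transforms inversely, so the trace is
    invariant. *)
Lemma laplacian_change w p : represented w -> O p ->
  laplacian g a w p = laplacian g b w p.
Proof.
move=> rw Op; have [ap bp] := Op.
pose X k q := cmap (atlas b) q 0 k.
pose J := transition_jac a b p; have Ju : J \in unitmx := jac_unitmx Op.
have rowJ k : differential a (X k) p = row k J by apply/rowP => i; rewrite !mxE.
pose Jb := transition_jac b b p.
have rowJb k : differential b (X k) p = row k Jb.
  by apply/rowP => i; rewrite !mxE.
(* The chain rule from a to b, applied to the coordinates of b, reads
   J = Jb J, and J is invertible. *)
have Jb1 : Jb = 1%:M.
  apply: (can_inj (mulmxK Ju)); rewrite mul1mx; apply/row_matrixP => k.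
  rewrite row_mul -rowJb -(differential_change (coord_represented k) Op).
  exact: rowJ.
pose Na := invmx (g a p) *m hessian g a w p *m invmx (g a p).
pose Nb := invmx (g b p) *m hessian g b w p *m invmx (g b p).
have hessJ : J *m Na *m J^T = Nb.
  rewrite -[RHS]mul1mx -[RHS]mulmx1 -[X in _ = _ *m X]trmx1.
  apply/matrixP => k l.
  have entry (M N : 'M[R]_n) :
      (M *m N *m M^T) k l = (row k M *m N *m (row l M)^T) 0 0.
    by rewrite tr_row -row_mul colE mulmxA -colE -row_mul !mxE.
  have := hessian_change (coord_represented k) (coord_represented l) rw Op.
  by rewrite !entry -/(X k) -/(X l) !rowJ !rowJb Jb1 /Na /Nb !mulmxA.
have lapE c : dom (atlas c) p -> laplacian g c w p =
    \tr (invmx (g c p) *m hessian g c w p *m invmx (g c p) *m g c p).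
  by move=> cp; rewrite mulmxKV //; apply: metric_unitmx.
rewrite (lapE b bp) (lapE a ap) -/Na -/Nb -hessJ (metric_tensor g ap bp) -/J.
by rewrite [in LHS]mulmxA mxtrace_mulC !mulmxA.
Qed.

End ChartChange.

(** * The conserved quantity *)

Section Conservation.
Variables (R : realType) (n : nat) (B : manifold R n) (g : riemannian_metric B).
Variables (m : R) (f lambda phi : B -> R).

Definition first_integral (a : chart_index B) (p : B) : R :=
  lambda p * f p ^+ 2 + f p * laplacian g a f p
  + (m - 1) * grad_inner g a f f p - f p * grad_inner g a phi f p.

Hypotheses (f_smooth : smooth f) (phi_smooth : smooth phi)
  (lambda_smooth : smooth lambda).

Lemma first_integral_change a b p : dom (atlas a) p -> dom (atlas b) p ->
  first_integral a p = first_integral b p.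
Proof.
move=> ap bp; have Op : (dom (atlas a) `&` dom (atlas b)) p by [].
have rep u (u_smooth : smooth u) :
    (exists V, represents (Oo := overlap_open a b)
      (Oa := @subIsetl _ (dom (atlas a)) (dom (atlas b))) u V) /\
    (exists V, represents (Oo := overlap_open a b)
      (Oa := @subIsetr _ (dom (atlas a)) (dom (atlas b))) u V).
  by split; apply: represents_smooth.
have rf := rep f f_smooth; have rphi := rep phi phi_smooth.
rewrite /first_integral (laplacian_change g rf Op).
by rewrite (grad_inner_change g rf rf Op) (grad_inner_change g rphi rf Op).
Qed.

(* Evaluation at a point enters through the next four ring identities only. *)
Lemma rmorph_first_integral (A A' : comPzRingType) (ev : {rmorphism A -> A'})
    (l u x k y z : A) :
  ev (l * u ^+ 2 + u * x + (k - 1) * y - u * z) =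
  ev l * ev u ^+ 2 + ev u * ev x + (ev k - 1) * ev y - ev u * ev z.
Proof.
by rewrite !expr2 rmorphB !rmorphD !rmorphM rmorphB rmorph1.
Qed.

Lemma map_mx_structure (A A' : comPzRingType) (ev : {rmorphism A -> A'})
    (X Y Z T : 'M[A]_n) (l k w : A) :
  map_mx ev X + map_mx ev Y
  = ev l *: map_mx ev Z + (ev k * ev w) *: map_mx ev T ->
  map_mx ev (X + Y) = map_mx ev (l *: Z + (k * w) *: T).
Proof. by rewrite !map_mxD !map_mxZ rmorphM. Qed.

Lemma rmorph_differential_eq (A A' : comPzRingType) (ev : {rmorphism A -> A'})
    (l x y : A) : ev (- 2 * l * x + y) = - 2 * ev l * ev x + ev y.
Proof. by rewrite rmorphD !rmorphM rmorphN rmorph_nat. Qed.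

Lemma rmorph_potential (A A' : comPzRingType) (ev : {rmorphism A -> A'})
    (l x y k w z : A) :
  ev ((2 - k - n%:R) * l + x - y - k * w * z) =
  (2 - ev k - n%:R) * ev l + ev x - ev y - ev k * ev w * ev z.
Proof.
by rewrite !rmorphB rmorphD !rmorphM !rmorphB !rmorph_nat.
Qed.

Hypotheses (m_neq0 : m != 0) (f_gt0 : forall p, 0 < f p).
Hypothesis ricci_hessian : forall (a : chart_index B) p, dom (atlas a) p ->
  ricci g a p + hessian g a phi p
  = lambda p *: g a p + (m / f p) *: hessian g a f p.
Hypothesis differential_eq : forall (a : chart_index B) p, dom (atlas a) p ->
  forall i : 'I_n,
  - 2 * lambda p * pd a i phi p
  + pd a i (fun q => (2 - m - n%:R) * lambda q + grad_inner g a phi phi q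
                     - laplacian g a phi q
                     - m / f q * grad_inner g a phi f q) p = 0.

(** Transport the two hypotheses to the ring of the chart, apply
    [hamilton_identity] there, and read its conclusion back. *)
Lemma first_integral_locally_constant a p : dom (atlas a) p ->
  \forall q \near p, first_integral a q = first_integral a p.
Proof.
pose Oo := @dom_open _ _ _ (atlas a); pose Oa := @subset_refl _ (dom (atlas a)).
have [F fF] := represents_smooth Oo Oa (f_smooth a).
have [L lL] := represents_smooth Oo Oa (lambda_smooth a).
have [P phiP] := represents_smooth Oo Oa (phi_smooth a).
have [G [H [GP HG]]] := metric_represents Oo Oa g.
pose So := chart_image_open Oo Oa.
pose M := sfun_cst So m.
have Mm q (Oq : dom (atlas a) q) : m = ev_at Oq M := represents_cst Oo Oa m Oq.
have [w wF] : exists w, w * F = 1.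
  apply: sfun_inv => _ [q Oq <-]; rewrite -[X in X != 0](fF q Oq).
  exact: lt0r_neq0.
have wf q (Oq : dom (atlas a) q) : (f q)^-1 = ev_at Oq w.
  have e : ev_at Oq w * f q = 1.
    rewrite (fF q Oq).
    apply: etrans (esym (rmorphM (ev_at (Oo := Oo) (Oa := Oa) Oq) w F)) _.
    by rewrite wF; apply: rmorph1.
  by apply: (mulIf (lt0r_neq0 (f_gt0 q))); rewrite e mulVf // lt0r_neq0.
pose half := sfun_cst So 2^-1.
pose D := @chart_d _ _ _ _ _ Oo Oa.
have lapE u U (uU : represents u U) := represents_laplacian GP HG uU.
have dotE u v U V (uU : represents u U) (vV : represents v V) :=
  represents_grad_inner GP HG uU vV.
have structure : ric D half G H + hess D half G H P
    = L *: G + (M * w) *: hess D half G H F.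
  apply: represents_inj_mx => q Oq; apply: map_mx_structure.
  rewrite (ev_ric GP HG) (ev_hess GP HG Oq phiP) (ev_hess GP HG Oq fF).
  rewrite (ev_metric GP); have E := ricci_hessian Oq.
  by rewrite (lL q Oq) {1}(Mm q Oq) (wf q Oq) in E.
have diff_eq i : - 2 * L * D i P
    + D i ((2 - M - n%:R) * L + gdot D H P P - lap D half G H P
           - M * w * gdot D H P F) = 0.
  set E := (X in _ + D i X = 0).
  have potE : represents (fun q => (2 - m - n%:R) * lambda q
      + grad_inner g a phi phi q - laplacian g a phi q
      - m / f q * grad_inner g a phi f q) E.
    move=> q Oq; rewrite /E.
    apply: (etrans _ (esym (rmorph_potential
      (ev_at (Oo := Oo) (Oa := Oa) Oq) _ _ _ _ _ _))).
    rewrite (lL q Oq) (wf q Oq) (dotE _ _ _ _ phiP phiP q Oq).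
    by rewrite (lapE _ _ phiP q Oq) (dotE _ _ _ _ phiP fF q Oq) {1 2}(Mm q Oq).
  apply: represents_inj => q Oq.
  apply: (etrans (rmorph_differential_eq
    (ev_at (Oo := Oo) (Oa := Oa) Oq) _ _ _)).
  apply: (etrans _ (esym (rmorph0 (ev_at (Oo := Oo) (Oa := Oa) Oq)))).
  have eqn := differential_eq Oq i.
  rewrite (lL q Oq) (represents_pd i phiP Oq) in eqn.
  by rewrite (represents_pd i potE Oq) in eqn.
have MV : M * sfun_cst So m^-1 = 1.
  apply: represents_inj => q Oq.
  apply: (etrans (rmorphM (ev_at (Oo := Oo) (Oa := Oa) Oq) _ _)).
  apply: (etrans _ (esym (rmorph1 _))).
  have E := mulfV m_neq0.
  by rewrite {1}(Mm q Oq) (represents_cst Oo Oa m^-1 Oq) in E.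
have DM i : D i M = 0 by apply: sfun_partial_cst.
apply: (represents_locally_constant (V := L * F ^+ 2 + F * lap D half G H F
  + (M - 1) * gdot D H F F - F * gdot D H P F)).
  move=> q Oq; apply: etrans (esym (rmorph_first_integral _ _ _ _ _ _ _)).
  rewrite /first_integral (lL q Oq) (lapE _ _ fF q Oq).
  rewrite (dotE _ _ _ _ fF fF q Oq) (dotE _ _ _ _ phiP fF q Oq).
  by rewrite (fF q Oq) {1}(Mm q Oq).
exact: (hamilton_identity (@sfun_partialM _ _ _ So) (@sfun_partialC _ _ _ So)
  (sfun_half So) (metric_model_sym GP) HG DM MV wF structure diff_eq).
Qed.

(** The level sets are open, hence also closed. *)
Lemma first_integral_constant : connected [set: B] ->
  exists mu, forall a p, dom (atlas a) p -> first_integral a p = mu.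
Proof.
move=> connB.
have [[p0 _]|noB] := pselect (exists p : B, True); last first.
  by exists 0 => a p; case: noB; exists p.
have /choice[c cP] : forall p : B, exists a, dom (atlas a) p.
  exact: atlas_cover.
pose Q p := first_integral (c p) p.
have QE a p : dom (atlas a) p -> first_integral a p = Q p.
  by move=> ap; apply: first_integral_change.
have Qloc p : \forall q \near p, Q q = Q p.
  have Q1 := first_integral_locally_constant (cP p).
  have d1 : \forall q \near p, dom (atlas (c p)) q.
    by apply: open_nbhs_nbhs; split; [apply: dom_open|].
  by apply: filterS2 Q1 d1 => q Qq dq; rewrite -(QE _ _ dq) Qq.
have openQ (P : set R) : open (Q @^-1` P).
  rewrite openE => p Pp; apply: filterS (Qloc p) => q.
  by rewrite /preimage /= => ->.
exists (Q p0) => a p ap; rewrite (QE _ _ ap).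
have /connB E : Q @^-1` [set Q p0] !=set0 by exists p0.
have : (Q @^-1` [set Q p0]) p; last by [].
rewrite E //; first by exists (Q @^-1` [set Q p0]); rewrite ?setTI.
exists (Q @^-1` [set Q p0]); rewrite ?setTI //.
by rewrite -openC; apply: (openQ (~` [set Q p0])).
Qed.

End Conservation.

Theorem proposition1 (R : realType) (n : nat) (B : manifold R n)
    (B_connected : connected [set: B]) (g : riemannian_metric B)
    (m : R) (m_neq0 : m != 0) (f lambda phi : B -> R)
    (f_smooth : smooth f) (lambda_smooth : smooth lambda)
    (phi_smooth : smooth phi) (f_gt0 : forall p, 0 < f p)
    (ricci_hessian : forall (a : chart_index B) (p : B), dom (atlas a) p ->
      ricci g a p + hessian g a phi p
      = lambda p *: g a p + (m / f p) *: hessian g a f p)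
    (differential_eq : forall (a : chart_index B) (p : B), dom (atlas a) p ->
      forall i : 'I_n,
      - 2 * lambda p * pd a i phi p
      + pd a i (fun q => (2 - m - n%:R) * lambda q + grad_inner g a phi phi q
                         - laplacian g a phi q
                         - m / f q * grad_inner g a phi f q) p = 0) :
  exists mu : R, forall (a : chart_index B) (p : B), dom (atlas a) p ->
    lambda p * f p ^+ 2 + f p * laplacian g a f p
    + (m - 1) * grad_inner g a f f p - f p * grad_inner g a phi f p = mu.
Proof.
exact: (first_integral_constant f_smooth phi_smooth lambda_smooth m_neq0 f_gt0
  ricci_hessian differential_eq B_connected).
Qed.
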